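(* Let $x>0$ and $n\in\mathbb{Z}^+$. Then \begin{align*} \lim_{\nu\rightarrow n} \frac{I_{\nu-1/2}(x)-\mathbf{L}_{1/2-\nu}(x)}{\sin(\pi\nu)}&=\frac{2}{\pi^{3/2}}(n-1)!\bigg(\frac{2}{x}\bigg)^{n-1/2}\sum_{k=1}^n\binom{2n-k-1}{n-1}\frac{2^{k-2n}}{(k-1)!}\\ &\quad\times\bigg\{x^{k-1}\big[\mathrm{e}^{-x}\mathrm{Ei}(x)+(-1)^k\mathrm{e}^{x}\mathrm{Ei}(-x)\big]-\sum_{j=1}^{k-1}(j-1)!\big[1+(-1)^{k+j}\big]x^{k-j-1}\bigg\}. \end{align*}
   Context: $\mathbb{Z}^+$ is the set of positive integers; the limit is over real $\nu\to n$, $\nu\neq n$. For real $\nu$ and $x>0$, $I_\nu(x)=\sum_{k=0}^\infty \frac{(x/2)^{2k+\nu}}{k!\,\Gamma(k+\nu+1)}$ is the modified Bessel function of the first kind and $\mathbf{L}_\nu(x)=\sum_{k=0}^\infty \frac{(x/2)^{2k+\nu+1}}{\Gamma(k+3/2)\,\Gamma(k+\nu+3/2)}$ is the modified Struve function of the first kind (with $1/\Gamma$ taken to be $0$ at the poles of $\Gamma$). $\mathrm{Ei}$ denotes the exponential integral: for $x>0$, $\mathrm{Ei}(x)=-\int_{-x}^\infty \mathrm{e}^{-t}/t\,\mathrm{d}t=\int_{-\infty}^x \mathrm{e}^{t}/t\,\mathrm{d}t$ (Cauchy principal value integrals) and $\mathrm{Ei}(-x)=-\int_x^\infty \mathrm{e}^{-t}/t\,\mathrm{d}t$.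 Empty sums are equal to zero. *)

(* Defs.v *)
From mathcomp Require Import all_boot all_order all_algebra.
From mathcomp Require Import all_classical all_reals all_analysis.

Set Implicit Arguments.
Unset Strict Implicit.
Unset Printing Implicit Defensive.

Import Order.TTheory GRing.Theory Num.Theory.
Import numFieldNormedType.Exports.

Local Open Scope classical_set_scope.
Local Open Scope ring_scope.

(* Euler's integral, meaningful for z > 0 only. *)
Definition euler_gamma (R : realType) (z : R) : R :=
  \int[@lebesgue_measure R]_(t in `]0, +oo[) (t `^ (z - 1) * expR (- t)).

(* For z <= 0 the functional equation is iterated m times, where m is the
   least natural number such that z + m > 0.  At z = 0, -1, -2, ... the product
   vanishes, and since 0^-1 = 0 both Gamma z and (Gamma z)^-1 are 0 there; so
   (Gamma z)^-1 is the reciprocal Gamma function on the whole real line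
   (see invGamma_pole). *)
Definition Gamma (R : realType) (z : R) : R :=
  if 0 < z then euler_gamma z
  else let m := (Num.truncn (- z)).+1 in
       euler_gamma (z + m%:R) / \prod_(i < m) (z + i%:R).

Lemma invGamma_pole (R : realType) (k : nat) : (Gamma (- k%:R : R))^-1 = 0.
Proof.
rewrite /Gamma oppr_gt0 ltrn0 /= opprK natrK big_ord_recr /= addNr mulr0.
by rewrite invr0 mulr0 invr0.
Qed.

Definition besselI (R : realType) (nu x : R) : R :=
  limn (series (fun k : nat =>
    (x / 2) `^ ((2 * k)%:R + nu) / (k`!%:R * Gamma (k%:R + nu + 1)))).

Definition struveL (R : realType) (nu x : R) : R :=
  limn (series (fun k : nat =>
    (x / 2) `^ ((2 * k)%:R + nu + 1) /
    (Gamma (k%:R + 3 / 2) * Gamma (k%:R + nu + 3 / 2)))).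

(* - \int_(-x)^oo e^(-t) / t dt, as a Cauchy principal value at t = 0 when
   x > 0; the value at x = 0 is meaningless. *)
Definition Ei (R : realType) (x : R) : R :=
  let mu := @lebesgue_measure R in
  let f := fun t : R => expR (- t) / t in
  if 0 < x then
    - lim ((\int[mu]_(t in `[- x, - e]) f t + \int[mu]_(t in `[e, +oo[) f t)
             @[e --> 0^'+])
  else - \int[mu]_(t in `[- x, +oo[) f t.

(* Main.v *)
From HB Require Import structures.
Require Import Defs.
From mathcomp Require Import all_boot all_order all_algebra.
From mathcomp Require Import all_classical all_reals all_analysis.
From mathcomp Require Import measurable_realfun zify ring lra.

Import Order.TTheory GRing.Theory Num.Theory.
Import numFieldNormedType.Exports.

Local Open Scope classical_set_scope.
Local Open Scope ring_scope.

(** Write w = x/2, y = w^2 and g = 1/Gamma, an everywhere defined function with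
    g(z) = z g(z+1), and put Z(p,q) = sum_k y^k g(k+p) g(k+q).  Then
    I_mu = w^mu Z(1,mu+1) and L_mu = w^(mu+1) Z(3/2,mu+3/2).  At nu = n the
    difference D(nu) = I_(nu-1/2)(x) - L_(1/2-nu)(x) vanishes, since the terms of
    L_(1/2-n) with a pole of Gamma drop out and the others are those of
    I_(n-1/2).  Hence the limit is D'(n) / (pi (-1)^n).

    The derivative is computed for n = 1 and n = 2 only, because everything obeys a
    three-term recursion.  From Z(p,q) = g(p) g(q) + y Z(p+1,q+1) and
    Z(p,q) - Z(p-1,q+1) = (q-p+1) Z(p,q+1) one gets (bsDiff_rec)
      D(nu+1) = D(nu-1) - (2nu-1)/x D(nu) - w^(1/2-nu) g(1/2) g(2-nu),
    and the last term over sin(pi nu) has a limit at n >= 2, as both factors have a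
    simple zero there (cvg_rgamma_sin).  The right-hand side satisfies the same
    recursion (sum_wcoef_rec): the brackets B_k in braces satisfy
    B_(k+2) = x^2 B_k - 2 (k-1)! x, their coefficients a binomial three-term
    identity, and the inhomogeneous parts match by
    sum_(j <= m) C(m+j,m) 2^-j = 2^m.

    For n = 1, 2 the series Z(p,q) is differentiated in q term by term (tannery,
    is_derive_gser), which brings in the digamma function psi.  The duplication
    formulas for g and psi turn the result into the even and odd parts of
    sum_k x^k/k! (ln x - psi(k+1)), and
      sum_k x^k/k! (ln x - psi(k+1))        = e^x Ei(-x),
      sum_k (-1)^k x^k/k! (ln x - psi(k+1)) = e^-x Ei(x).
    To see these, let M(t) = e^-t sum_k psi(k+1) t^k/k!.  Its derivative is
    (1 - e^-t)/t, so ln|t| - M(t) is an antiderivative of e^-t/t; it tends to 0 at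
    +oo, because ln t - 1/t <= M(t) <= ln(t+1) by tangent-line bounds on the
    logarithm under the Poisson weights e^-t t^k/k!.  The continuity of M at 0
    gives the principal value.

    The facts on Gamma come from its functional equation and from the inequality
    Gamma(z+s) <= z^s Gamma(z), 0 <= s <= 1 (euler_gamma_wendel), which is the
    tangent inequality for t^s integrated against t^(z-1) e^-t.  Iterating it gives
      s psi(a) <= ln Gamma(a+s) - ln Gamma(a) <= s psi(a+s)
    with psi(a) = lim (ln(a+N) - sum_(k<N) 1/(a+k)); as psi is continuous, it is the
    derivative of ln Gamma. *)

(** * Euler's integral *)

Lemma cvg_powR {R : realType} (a z : R) : 0 < a ->
  {for a, continuous (fun t : R => t `^ z)}.
Proof.
move=> a0; apply: differentiable_continuous; apply/derivable1_diffP.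
by have [] := is_derive1_powR z a0.
Qed.

(** Monotone convergence along intervals [a_i, b_i] that exhaust the positive
    half-line. *)
Lemma cvg_integral_exhaust {R : realType} (f : R -> R) (a b : nat -> R) :
  (forall t, 0 < t -> 0 <= f t) -> (forall t, 0 < t -> {for t, continuous f}) ->
  (forall i, 0 < a i) -> nonincreasing_seq a -> nondecreasing_seq b ->
  (forall t, 0 < t -> exists i, a i <= t <= b i) ->
  (\int[@lebesgue_measure R]_(t in `[a i, b i]) (f t)%:E)%E @[i --> \oo] -->
  (\int[@lebesgue_measure R]_(t in `]0%R, +oo[) (f t)%:E)%E.
Proof.
move=> f0 cf a0 na nb ab.
pose F i : set R := `[a i, b i]%classic.
have Fpos i t : F i t -> 0 < t.
  by rewrite /F /= in_itv/= => /andP[+ _]; apply: lt_le_trans.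
have -> : `](0:R), +oo[%classic = \bigcup_i F i.
  apply/seteqP; split => [t|t [i _ /Fpos t0]] /=; last by rewrite in_itv/= t0.
  by rewrite in_itv/= andbT => /ab[i abi]; exists i => //; rewrite /F/= in_itv.
apply: ge0_nondecreasing_set_cvg_integral => //.
- move=> i j ij; apply/subsetPset => t; rewrite /F /= !in_itv /= => /andP[h1 h2].
  by rewrite (le_trans (na _ _ ij) h1) (le_trans h2 (nb _ _ ij)).
- move=> i; apply/measurable_EFinP.
  apply: (@measurable_funS _ _ _ _ `](0:R), +oo[%classic) => //.
  + by move=> t /Fpos t0 /=; rewrite in_itv/= t0.
  + apply: open_continuous_measurable_fun; first exact: interval_open.
    by move=> t; rewrite inE/= in_itv/= andbT => /cf.
- by move=> i t /Fpos /f0; rewrite lee_fin.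
Qed.

(** Stated on the integers i+1, the upper ends of the exhausting intervals. *)
Lemma cvgn_powR_expRN {R : realType} (z : R) :
  (i.+1%:R : R) `^ z * expR (- i.+1%:R) @[i --> \oo] --> 0.
Proof.
pose n := Num.truncn `|z|.
have zn : z <= n.+1%:R by rewrite (le_trans (ler_norm _))// ltW// truncnS_gt.
apply: (@squeeze_cvgr _ _ _ _ (cst 0) (fun i => n.+2`!%:R * harmonic i)).
- near=> i; rewrite mulr_ge0 ?powR_ge0 ?expR_ge0//=.
  rewrite expRN ler_pdivrMr ?expR_gt0// mulrAC ler_pdivlMr ?ltr0n//.
  have i1 : (1:R) <= i.+1%:R by rewrite ler1n.
  apply: (@le_trans _ _ (i.+1%:R ^+ n.+2)).
    rewrite [leRHS]exprSr ler_pM2r ?ltr0n// -powR_mulrn// ler_powR//.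
  have := expR_ge1Dxn n.+1 (le_trans ler01 i1).
  rewrite -ler_pdivrMl ?ltr0n ?fact_gt0// mulrC.
  by apply: le_trans; rewrite lerDr.
- exact: cvg_cst.
- rewrite -[X in _ --> X](mulr0 (n.+2`!%:R)).
  by apply: cvgM; [exact: cvg_cst|exact: cvg_harmonic].
Unshelve. all: by end_near. Qed.

(** Euler's integral as an extended real, so that finiteness can be proved
    after the functional equation. Its value is finite for z > 0. *)
Definition egamma {R : realType} (z : R) : \bar R :=
  (\int[@lebesgue_measure R]_(t in `]0%R, +oo[) (t `^ (z - 1) * expR (- t))%:E)%E.

Lemma gamma_integrand_continuous {R : realType} (z t : R) : 0 < t ->
  {for t, continuous (fun t : R => t `^ z * expR (- t))}.
Proof.
move=> t0; apply: cvgM; first exact: cvg_powR.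
by apply: continuous_comp; [exact: cvgN|exact: continuous_expR].
Qed.

Lemma within_continuous_pos {R : realType} (f : R -> R) (a b : R) : 0 < a ->
  (forall t, 0 < t -> {for t, continuous f}) -> {within `[a, b], continuous f}.
Proof.
move=> a0 cf; apply: continuous_in_subspaceT => t; rewrite inE/= in_itv/= => /andP[h _].
by apply: cf; apply: lt_le_trans h.
Qed.

Lemma derivable_oo_LRcontinuous_pos {R : realType} (f : R -> R) (a b : R) :
  0 < a -> a < b ->
  (forall t, 0 < t -> derivable f t 1) -> derivable_oo_LRcontinuous f a b.
Proof.
move=> a0 ab df.
have cf t : 0 < t -> {for t, continuous f}.
  by move=> /df ?; apply: differentiable_continuous; apply/derivable1_diffP.
split.
- by move=> t; rewrite in_itv/= => /andP[h _]; apply: df; apply: lt_trans h.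
- exact/cvg_at_right_filter/cf.
- by apply/cvg_at_left_filter/cf/(lt_trans a0).
Qed.

(** Ends of the intervals [1/(i+1), i+1], which exhaust the positive half-line
    and avoid the singularity of the integrand at 0. *)
Definition exhaust_lo {R : realType} (i : nat) : R := i.+1%:R^-1.

Definition exhaust_hi {R : realType} (i : nat) : R := i.+1%:R.

Lemma exhaustP {R : realType} :
  [/\ forall i, 0 < @exhaust_lo R i, nonincreasing_seq (@exhaust_lo R),
  nondecreasing_seq (@exhaust_hi R) & forall t : R, 0 < t -> exists i, exhaust_lo i <=
    t <= exhaust_hi i].
Proof.
split.
- by move=> i; rewrite invr_gt0 ltr0n.
- by move=> i j ij; rewrite /exhaust_lo lef_pV2 ?posrE ?ltr0n// ler_nat.
- by move=> i j ij; rewrite /exhaust_hi ler_nat.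
- move=> t t0; pose m := maxn (Num.truncn t) (Num.truncn t^-1).
  exists m; rewrite /exhaust_lo /exhaust_hi; apply/andP; split.
    rewrite -[leRHS]invrK lef_pV2 ?posrE ?ltr0n ?invr_gt0//.
    by rewrite (le_trans (ltW (truncnS_gt _)))// ler_nat ltnS leq_maxr.
  by rewrite (le_trans (ltW (truncnS_gt _)))// ler_nat ltnS leq_maxl.
Qed.

Lemma egamma_exhaust {R : realType} (z : R) :
  (\int[@lebesgue_measure R]_(t in `[exhaust_lo i, exhaust_hi i])
    (t `^ (z - 1) * expR (- t))%:E)%E
    @[i --> \oo] --> egamma z.
Proof.
have [h1 h2 h3 h4] := @exhaustP R.
apply: (@cvg_integral_exhaust R (fun t => t `^ (z - 1) * expR (- t))) => //.
- by move=> t t0; rewrite mulr_ge0// ?powR_ge0 ?expR_ge0.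
- by move=> t; apply: gamma_integrand_continuous.
Qed.

(** A limit transfers along a function that agrees eventually. *)
Lemma cvg_near_eq {T : Type} {F : set_system T} {FF : Filter F} {U : nbhsType}
  (f g : T -> U) (l : U) :
  (\forall x \near F, f x = g x) -> f x @[x --> F] --> l -> g x @[x --> F] --> l.
Proof. by move=> fg; apply: cvg_trans; exact: near_eq_cvg. Qed.

(** The boundary terms of the integration by parts that yields the functional
    equation. *)
Lemma cvg_boundary_terms {R : realType} (z : R) : 0 < z ->
  (exhaust_lo i) `^ z * expR (- exhaust_lo i) - (exhaust_hi i) `^ z *
    expR (- exhaust_hi i) @[i --> \oo] --> (0 : R).
Proof.
move=> z0; rewrite -(subrr (0:R)); apply: cvgB; last exact: cvgn_powR_expRN.
have a0 : (@exhaust_lo R i) @[i --> \oo] --> (0:R) by exact: cvg_harmonic.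
apply: (@squeeze_cvgr _ _ _ _ (cst 0) (fun i => (@exhaust_lo R i) `^ z)).
- near=> i; rewrite mulr_ge0 ?powR_ge0 ?expR_ge0//=.
  by rewrite ler_piMr ?powR_ge0// expR_le1 oppr_le0 invr_ge0.
- exact: cvg_cst.
- have /cvg_at_rightP := powR_cvg0 z0; apply; split => // i.
  by rewrite invr_gt0 ltr0n.
Unshelve. all: by end_near. Qed.

Lemma egamma_ge0 {R : realType} (z : R) : (0 <= egamma z)%E.
Proof. by apply: integral_ge0 => t _; rewrite lee_fin mulr_ge0// ?powR_ge0 ?expR_ge0. Qed.

Lemma is_derive_NexpRN {R : realType} (t : R) :
  is_derive t 1 (fun t : R => - expR (- t)) (expR (- t)).
Proof.
have h : is_derive t 1 (fun t : R => expR (- t)) (expR (- t) * -1).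
  by apply: (@is_derive1_comp _ expR -%R).
by apply: is_derive_eq; rewrite mulrN1 opprK.
Qed.

Lemma integrable_pos_continuous {R : realType} (f : R -> R) (a b : R) : 0 < a ->
  (forall t, 0 < t -> {for t, continuous f}) ->
  (@lebesgue_measure R).-integrable `[a, b] (fun t => (f t)%:E).
Proof.
move=> a0 cf; apply: continuous_compact_integrable; first exact: segment_compact.
exact: within_continuous_pos.
Qed.

Lemma egammaS {R : realType} (z : R) : 0 < z -> (egamma (z + 1) = z%:E * egamma z)%E.
Proof.
move=> z0.
(* Integration by parts on a compact subinterval. *)
have parts (a b : R) : 0 < a -> a < b ->
  ((\int[@lebesgue_measure R]_(t in `[a, b]) (t `^ (z + 1 - 1) * expR (- t))%:E) =
   (a `^ z * expR (- a) - b `^ z * expR (- b))%:E +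
   z%:E * \int[@lebesgue_measure R]_(t in `[a, b]) (t `^ (z - 1) * expR (- t))%:E)%E.
  move=> a0 ab; rewrite addrK.
  rewrite (@integration_by_parts R (fun t => t `^ z) (fun t => - expR (- t))
    (fun t => z * t `^ (z - 1)) (fun t => expR (- t)) a b) //; first last.
  - by move=> t _; rewrite derive1E; have [_ ->] := is_derive_NexpRN t.
  - by apply: derivable_oo_LRcontinuous_pos => // t _; have [] := is_derive_NexpRN t.
  - apply: within_continuous_pos => // t t0.
    by apply: continuous_comp; [exact: cvgN|exact: continuous_expR].
  - move=> t; rewrite in_itv/= => /andP[h _]; have t0 := lt_trans a0 h.
    by rewrite derive1E; have [_ ->] := is_derive1_powR z t0.
  - apply: derivable_oo_LRcontinuous_pos => // t t0.
    by have [] := is_derive1_powR z t0.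
  - apply: within_continuous_pos => // t t0; apply: cvgM;
    [exact: cvg_cst|exact: cvg_powR].
  congr (_ + _)%E; first by congr EFin; ring.
  transitivity (- ((- z)%:E *
      \int[@lebesgue_measure R]_(t in `[a, b]) (t `^ (z - 1) * expR (- t))%:E))%E.
    rewrite -integralZl//; last first.
      by apply: (integrable_pos_continuous (fun t => t `^ (z - 1) * expR (- t))) => //;
        move=> t; exact: gamma_integrand_continuous.
    by congr (- _)%E; apply: eq_integral => t _; rewrite -EFinM; congr EFin; ring.
  by rewrite EFinN mulNe oppeK.
apply: (cvg_unique _ (egamma_exhaust (z + 1))) => //.
have [a0 _ _ _] := @exhaustP R.
have ab i : (0 < i)%N -> @exhaust_lo R i < exhaust_hi i.
  move=> i0; rewrite /exhaust_lo /exhaust_hi (@lt_trans _ _ 1)//; last by rewrite ltr1n.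
  by rewrite invf_lt1 ?ltr0n// ltr1n.
apply: cvg_near_eq.
  by near=> i; rewrite parts//; apply: ab; near: i; exact: nbhs_infty_gt.
rewrite -[X in _ --> X]add0e; apply: cvgeD => //.
- by apply/fine_cvgP; split; [near=> i|exact: cvg_boundary_terms].
- by apply: cvgeZl => //; exact: egamma_exhaust.
Unshelve. all: by end_near. Qed.

Lemma egamma1 {R : realType} : @egamma R 1 = 1%E.
Proof.
apply: (cvg_unique _ (egamma_exhaust 1)) => //.
have [a0 _ _ _] := @exhaustP R.
have int (a b : R) : 0 < a -> a < b ->
  (\int[@lebesgue_measure R]_(t in `[a, b]) (t `^ (1 - 1) * expR (- t))%:E =
   (expR (- a) - expR (- b))%:E)%E.
  move=> a0' ab; under eq_integral do rewrite subrr powRr0 mul1r.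
  rewrite (@continuous_FTC2 R _ (fun t => - expR (- t)))//.
  - by rewrite -EFinB; congr EFin; ring.
  - apply: within_continuous_pos => // t t0.
    by apply: continuous_comp; [exact: cvgN|exact: continuous_expR].
  - by apply: derivable_oo_LRcontinuous_pos => // t _; have [] := is_derive_NexpRN t.
  - by move=> t _; rewrite derive1E; have [_ ->] := is_derive_NexpRN t.
have ab i : (0 < i)%N -> @exhaust_lo R i < exhaust_hi i.
  move=> i0; rewrite /exhaust_lo /exhaust_hi (@lt_trans _ _ 1)//; last by rewrite ltr1n.
  by rewrite invf_lt1 ?ltr0n// ltr1n.
apply: cvg_near_eq.
  by near=> i; rewrite int//; apply: ab; near: i; exact: nbhs_infty_gt.
apply/fine_cvgP; split; first by near=> i.
rewrite -[X in _ --> X](subr0 (1:R)); apply: cvgB.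
- rewrite -[X in _ --> X]expR0 -oppr0.
  apply: continuous_cvg; first exact: continuous_expR.
  by apply: cvgN; exact: cvg_harmonic.
- by have := @cvgn_expR R; rewrite -(cvg_shiftS (fun n => expR (- n%:R))).
Unshelve. all: by end_near. Qed.

(** A pointwise bound of one power by two others passes to the integrals. *)
Lemma egamma_le_lin {R : realType} (z z1 z2 c1 c2 : R) : 0 <= c1 -> 0 <= c2 ->
  (forall t, 0 < t -> t `^ (z - 1) <= c1 * t `^ (z1 - 1) + c2 * t `^ (z2 - 1)) ->
  (egamma z <= c1%:E * egamma z1 + c2%:E * egamma z2)%E.
Proof.
move=> c10 c20 h.
have mg w : measurable_fun `](0:R), +oo[ (fun t : R => (t `^ (w - 1) * expR (- t))%:E).
  apply/measurable_EFinP; apply: open_continuous_measurable_fun;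
    first exact: interval_open.
  by move=> t; rewrite inE/= in_itv/= andbT; exact: gamma_integrand_continuous.
have g0 w (t : R) : `]0%R, +oo[%classic t -> (0 <= (t `^ (w - 1) * expR (- t))%:E)%E.
  by move=> _; rewrite lee_fin mulr_ge0// ?powR_ge0 ?expR_ge0.
have mD : measurable (`](0:R), +oo[%classic : set (measurableTypeR R))
  by exact: measurable_itv.
have Z c w : 0 <= c -> (c%:E * egamma w =
    \int[@lebesgue_measure R]_(t in `]0%R, +oo[)
      (c%:E * (t `^ (w - 1) * expR (- t))%:E))%E.
  move=> c0; rewrite ge0_integralZl_EFin//; [exact: g0|exact: mg].
rewrite !Z// -ge0_integralD//=; first last.
- by apply: measurable_funeM; exact: mg.
- by move=> t t0; rewrite mule_ge0 ?lee_fin//; apply: (g0 _ t).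
- by apply: measurable_funeM; exact: mg.
- by move=> t t0; rewrite mule_ge0 ?lee_fin//; apply: (g0 _ t).
apply: ge0_le_integral => //=; first exact: g0; first exact: mg.
- by apply: emeasurable_funD; apply: measurable_funeM; exact: mg.
- move=> t; rewrite /= in_itv/= andbT => t0.
  rewrite -!EFinM -EFinD lee_fin !mulrA -mulrDl ler_pM2r ?expR_gt0//.
  exact: h.
Qed.

Lemma egamma_fin {R : realType} (z : R) : 0 < z -> egamma z \is a fin_num.
Proof.
(* At the integers by the recurrence, for w >= 1 from t^(w-1) <= 1 + t^n with
   w <= n + 1, and for z < 1 from the value at z + 1. *)
have fnat n : @egamma R n.+1%:R \is a fin_num.
  elim: n => [|n ih]; first by rewrite egamma1.
  by rewrite -natr1 egammaS// fin_numM.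
have f1 (w : R) : 1 <= w -> egamma w \is a fin_num.
  move=> w1; rewrite ge0_fin_numE ?egamma_ge0//.
  pose n := Num.truncn w.
  have wn : w <= n.+1%:R by rewrite ltW// truncnS_gt.
  apply: (@le_lt_trans _ _ (1%:E * egamma 1 + 1%:E * egamma n.+1%:R)%E).
    apply: egamma_le_lin => // t t0; rewrite !mul1r subrr powRr0.
    have [t1|t1] := leP t 1.
      rewrite (le_trans (y := 1))//; last by rewrite lerDl powR_ge0.
      by rewrite -[leRHS](powRr0 t) ger_powR ?t0// subr_ge0.
    rewrite (le_trans (y := t `^ (n.+1%:R - 1)))//; last by rewrite lerDr.
    by rewrite ler_powR ?(ltW t1)// lerD2r.
  by rewrite !mul1e (egamma1 (R := R)); have := fnat n;
    case: (egamma n.+1%:R) => // r _; exact: ltry.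
move=> z0; have := f1 (z + 1); rewrite lerDr => /(_ (ltW z0)); rewrite egammaS//.
rewrite !ge0_fin_numE ?egamma_ge0 ?mule_ge0 ?egamma_ge0 ?lee_fin ?(ltW z0)//.
by have := egamma_ge0 z; case: (egamma z) => [r| |]//= _; rewrite ?ltry// gt0_muley.
Qed.

Lemma euler_gammaE {R : realType} (z : R) : 0 < z -> (euler_gamma z)%:E = egamma z.
Proof. by move=> z0; rewrite /euler_gamma /Rintegral fineK// egamma_fin. Qed.

Lemma euler_gammaS {R : realType} (z : R) : 0 < z ->
  euler_gamma (z + 1) = z * euler_gamma z.
Proof.
move=> z0; apply: EFin_inj.
have z1 : 0 < z + 1 by rewrite addr_gt0.
by rewrite (euler_gammaE _ z1) EFinM (euler_gammaE z z0); exact: egammaS.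
Qed.

Lemma euler_gamma1 {R : realType} : euler_gamma (1 : R) = 1.
Proof. by apply: EFin_inj; rewrite euler_gammaE// egamma1. Qed.

(** The concave function t^s lies below its tangent at z. *)
Lemma powR_le_tangent {R : realType} (s t z : R) : 0 <= s <= 1 -> 0 < t -> 0 < z ->
  t `^ s <= (1 - s) * z `^ s + s * z `^ (s - 1) * t.
Proof.
move=> /andP[s0 s1] t0 z0.
rewrite /powR !gt_eqF//.
set a := ln z; set b := ln t.
have tE : t = expR b by rewrite lnK.
rewrite -mulrA [in leRHS]tE -expRD.
(* Divided by exp (s b), the right-hand side is the mean of exp at two points, with
   weights 1 - s and s; the mean of the points is 0, and exp u >= 1 + u. *)
have h1 := expR_ge1Dx (s * a - s * b).
have h2 := expR_ge1Dx ((s - 1) * a + b - s * b).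
have -> : expR (s * a) = expR (s * b) * expR (s * a - s * b) by rewrite -expRD;
  congr expR; ring.
have -> : expR ((s - 1) * a + b) = expR (s * b) * expR ((s - 1) * a + b - s * b).
  by rewrite -expRD; congr expR; ring.
rewrite mulrCA [X in _ + X]mulrCA -mulrDr ler_peMr ?expR_ge0//.
have h3 : (1 - s) * (1 + (s * a - s * b)) <= (1 - s) *
  expR (s * a - s * b) by rewrite ler_wpM2l// subr_ge0.
have h4 : s * (1 + ((s - 1) * a + b - s * b)) <=
  s * expR ((s - 1) * a + b - s * b) by rewrite ler_wpM2l.
apply: le_trans (lerD h3 h4).
by rewrite le_eqVlt; apply/orP; left; apply/eqP; ring.
Qed.

(** Wendel's inequality: powR_le_tangent integrated against t^(z-1) e^-t. *)
Lemma euler_gamma_wendel {R : realType} (z s : R) : 0 < z -> 0 <= s <= 1 ->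
  euler_gamma (z + s) <= z `^ s * euler_gamma z.
Proof.
move=> z0 s01; have /andP[s0 s1] := s01.
have zs0 : 0 < z + s by rewrite ltr_pwDl.
rewrite -lee_fin euler_gammaE// EFinM euler_gammaE//.
apply: (@le_trans _ _ (((1 - s) * z `^ s)%:E * egamma z +
   (s * z `^ (s - 1))%:E * egamma (z + 1))%E).
  apply: egamma_le_lin => [||t t0].
  - by rewrite mulr_ge0 ?powR_ge0// subr_ge0.
  - by rewrite mulr_ge0 ?powR_ge0.
  - have [p pE] : exists p, z - 1 = p by exists (z - 1).
    rewrite pE.
    have -> : z + s - 1 = p + s by rewrite -pE; ring.
    have -> : z + 1 - 1 = p + 1 by rewrite -pE; ring.
    rewrite !(@powRD _ t)// ?(gt_eqF t0) ?implybT// (powRr1 (ltW t0)).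
    have := powR_le_tangent s t z s01 t0 z0.
    rewrite -(@ler_pM2l _ (t `^ p)) ?powR_gt0// => /le_trans; apply.
    by rewrite le_eqVlt; apply/orP; left; apply/eqP; ring.
rewrite -!euler_gammaE ?addr_gt0// -!EFinM -EFinD lee_fin euler_gammaS//.
rewrite le_eqVlt; apply/orP; left; apply/eqP.
have -> : z `^ s = z `^ (s - 1) * z.
  by rewrite -[X in _ * X](powRr1 (ltW z0)) -powRD ?subrK// (gt_eqF z0) implybT.
by ring.
Qed.

Lemma euler_gamma_nat {R : realType} (n : nat) : euler_gamma (n.+1%:R : R) = n`!%:R.
Proof.
elim: n => [|n ih]; first by rewrite fact0 euler_gamma1.
by rewrite -natr1 euler_gammaS// ih factS natrM.
Qed.

(** If Gamma vanished at z, it would vanish by Wendel's inequality at the next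
    integer, where it is a factorial. *)
Lemma euler_gamma_gt0 {R : realType} (z : R) : 0 < z -> 0 < euler_gamma z.
Proof.
move=> z0; rewrite lt_neqAle; apply/andP; split; last first.
  by rewrite -lee_fin euler_gammaE// egamma_ge0.
apply/eqP => G0.
pose n := Num.truncn z.
have /andP[h1 h2] := Num.Theory.truncn_itv (ltW z0).
have s01 : 0 <= n.+1%:R - z <= 1.
  by rewrite subr_ge0 (ltW h2)/= lerBlDl -natr1 [z + 1]addrC [1 + z]addrC lerD2r h1.
have := euler_gamma_wendel z _ z0 s01.
rewrite -G0 mulr0 subrKC euler_gamma_nat => h.
by have : 0 < (n`!%:R : R) by [rewrite ltr0n fact_gt0]; rewrite ltNge h.
Qed.

Lemma is_derive_sqr {R : realType} (u : R) : is_derive u 1 (fun u : R => u ^+ 2) (2 * u).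
Proof.
by apply: DeriveDef; [exact: exprn_derivable|rewrite exp_derive /= expr1 [_ *: _]mulr1].
Qed.

(** The substitution t = u^2 reduces this to the Gauss integral. *)
Lemma euler_gamma_half {R : realType} : euler_gamma (1 / 2 : R) = Num.sqrt pi.
Proof.
apply: EFin_inj; rewrite euler_gammaE; last by rewrite divr_gt0.
have [a0 na nb ex] := @exhaustP R.
pose a i := @exhaust_lo R i ^+ 2; pose b i := @exhaust_hi R i ^+ 2.
have b0 i : 0 < @exhaust_hi R i by rewrite ltr0n.
have ex2 : forall t : R, 0 < t -> exists i, a i <= t <= b i.
  move=> t t0; have s0 : 0 < Num.sqrt t by rewrite sqrtr_gt0.
  have [i /andP[h1 h2]] := ex _ s0; exists i.
  rewrite -(sqr_sqrtr (ltW t0)); apply/andP; split; rewrite lerXn2r// nnegrE ltW//.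
have c1 := cvg_integral_exhaust (fun t : R => t `^ (1 / 2 - 1) * expR (- t)) a b.
have c2 := cvg_integral_exhaust (fun t : R => 2 * expR (- t ^+ 2)) exhaust_lo exhaust_hi.
rewrite -/(egamma (1/2)) in c1.
have {}c1 : (\int[@lebesgue_measure R]_(t in `[a i, b i])
   (t `^ (1 / 2 - 1) * expR (- t))%:E)%E @[i --> \oo] --> egamma (1 / 2 : R).
  apply: c1 => //.
  - by move=> t t0; rewrite mulr_ge0 ?powR_ge0 ?expR_ge0.
  - by move=> t; exact: gamma_integrand_continuous.
  - by move=> i; rewrite exprn_gt0.
  - by move=> i j ij; rewrite lerXn2r ?nnegrE ?(ltW (a0 _))//; exact: na.
  - by move=> i j ij; rewrite lerXn2r ?nnegrE ?(ltW (b0 _))//; exact: nb.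
have gc (t : R) : {for t, continuous (fun t : R => 2 * expR (- t ^+ 2))}.
  apply: cvgM; first exact: cvg_cst.
  exact: continuous_gauss_fun.
have {}c2 : (\int[@lebesgue_measure R]_(t in `[exhaust_lo i, exhaust_hi i])
   (2 * expR (- t ^+ 2))%:E)%E @[i --> \oo] --> (Num.sqrt pi : R)%:E.
  have <- : (\int[@lebesgue_measure R]_(t in `]0%R, +oo[) (2 * expR (- t ^+ 2))%:E)%E =
    (Num.sqrt pi : R)%:E.
    rewrite integral_itv_obnd_cbnd; last first.
      apply: measurable_funTS; apply/measurable_EFinP; exact: continuous_measurable_fun.
    under eq_integral do rewrite EFinM.
    rewrite ge0_integralZl_EFin//; last first.
      by apply: measurable_funTS; apply/measurable_EFinP; exact: measurable_gauss_fun.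
    have := @integral0y_gauss R; rewrite /gauss_fun => ->.
    by rewrite -EFinM; congr EFin; field.
  by apply: c2 => // t _; rewrite mulr_ge0 ?expR_ge0.
apply: (cvg_unique _ c1); first exact: ereal_hausdorff.
rewrite /=; apply: cvg_near_eq c2; near=> i.
have abi : @exhaust_lo R i <= exhaust_hi i.
  by rewrite (@le_trans _ _ 1)//; [rewrite invf_le1 ?ltr0n// ler1n|rewrite ler1n].
have dE : derive1 (fun u : R => u ^+ 2) = (fun u => 2 * u).
  by apply/funext => u; rewrite derive1E; have [_ ->] := is_derive_sqr u.
rewrite (@integration_by_substitution_increasing R (fun u => u ^+ 2) _ (exhaust_lo i)
  (exhaust_hi i))//.
- rewrite dE; apply: eq_integral => t; rewrite inE/= in_itv/= => /andP[h _]; congr EFin.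
  have t0 : 0 < t by apply: lt_le_trans h; exact: a0.
  rewrite !fctE -powR_mulrn ?ltW// -powRrM (_ : 2 * (1 / 2 - 1) = -1); last by field.
  rewrite powR_inv1 ?ltW//; field.
  by rewrite gt_eqF.
- move=> u v; rewrite !in_itv/= => /andP[hu _] /andP[hv _] uv.
  by rewrite ltrXn2r// ?nnegrE ?(le_trans (ltW (a0 i)))//.
- by rewrite dE => u _; apply: cvgM; [exact: cvg_cst|exact: cvg_id].
- rewrite dE; apply/cvg_ex; exists (2 * exhaust_lo i); apply: cvg_at_right_filter.
  by apply: cvgM; [exact: cvg_cst|exact: cvg_id].
- rewrite dE; apply/cvg_ex; exists (2 * exhaust_hi i); apply: cvg_at_left_filter.
  by apply: cvgM; [exact: cvg_cst|exact: cvg_id].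
- split.
  + by move=> u _; have [] := is_derive_sqr u.
  + by apply: cvg_at_right_filter; exact: exprn_continuous.
  + by apply: cvg_at_left_filter; exact: exprn_continuous.
- apply: within_continuous_pos; first by rewrite exprn_gt0.
  by move=> t; exact: gamma_integrand_continuous.
Unshelve. all: by end_near. Qed.

(** * The digamma function as a limit *)

Lemma lnB_le {R : realType} (x y : R) : 0 < x -> 0 < y -> ln y - ln x <= (y - x) / x.
Proof.
move=> x0 y0; rewrite -ln_div//.
have -> : y / x = 1 + (y - x) / x by field; rewrite gt_eqF.
apply: le_ln1Dx; rewrite -subr_gt0.
have -> : (y - x) / x - -1 = y / x by field; rewrite gt_eqF.
by rewrite divr_gt0.
Qed.

Lemma lnB_ge {R : realType} (x y : R) : 0 < x -> 0 < y -> (y - x) / y <= ln y - ln x.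
Proof.
move=> x0 y0; rewrite -lerN2 opprB -mulNr opprB; exact: lnB_le.
Qed.

(** Upper approximants of the digamma function; subtracting 1/(a+N) gives
    lower approximants. *)
Definition psi_seq {R : realType} (a : R) (N : nat) : R :=
  ln (a + N%:R) - \sum_(0 <= k < N) (a + k%:R)^-1.

(** The digamma function on the positive half-line, as a limit; it is the
    derivative of lnGamma by is_derive_lnGamma. *)
HB.lock Definition psi {R : realType} (a : R) : R := limn (psi_seq a).

Lemma psi_seq_decr {R : realType} (a : R) : 0 < a -> nonincreasing_seq (psi_seq a).
Proof.
move=> a0; apply/nonincreasing_seqP => N; rewrite /psi_seq big_nat_recr//=.
have aN : 0 < a + N%:R by rewrite ltr_pwDl.
have aN1 : 0 < a + N.+1%:R by rewrite ltr_pwDl.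
have := lnB_le _ _ aN aN1.
have -> : (a + N.+1%:R - (a + N%:R)) / (a + N%:R) = (a + N%:R)^-1.
  by rewrite -natr1; field; rewrite gt_eqF.
lra.
Qed.

Lemma psi_seq_incr {R : realType} (a : R) : 0 < a ->
  nondecreasing_seq (fun N => psi_seq a N - (a + N%:R)^-1).
Proof.
move=> a0; apply/nondecreasing_seqP => N; rewrite /psi_seq big_nat_recr//=.
have aN : 0 < a + N%:R by rewrite ltr_pwDl.
have aN1 : 0 < a + N.+1%:R by rewrite ltr_pwDl.
have := lnB_ge _ _ aN aN1.
have -> : (a + N.+1%:R - (a + N%:R)) / (a + N.+1%:R) = (a + N.+1%:R)^-1.
  by rewrite -natr1; field; rewrite natr1 gt_eqF.
lra.
Qed.

Lemma cvg_invDn {R : realType} (a : R) : 0 < a -> (a + N%:R)^-1 @[N --> \oo] --> 0.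
Proof.
move=> a0; rewrite -(cvg_shiftS (fun N => (a + N%:R)^-1)).
apply: (@squeeze_cvgr _ _ _ _ (cst 0) (@harmonic R)).
- near=> N => /=.
  have aN : 0 < a + N.+1%:R by rewrite ltr_pwDl.
  by rewrite invr_ge0 (ltW aN)/= lef_pV2 ?posrE// lerDr ltW.
- exact: cvg_cst.
- exact: cvg_harmonic.
Unshelve. all: by end_near. Qed.

Lemma psi_seq_cvg {R : realType} (a : R) : 0 < a -> psi_seq a @ \oo --> psi a.
Proof.
move=> a0; rewrite psi.unlock; apply: (nonincreasing_is_cvgn (psi_seq_decr a a0)).
exists (psi_seq a 0 - (a + 0%:R)^-1) => _ [N _ <-].
have := psi_seq_incr a a0 0 N (leq0n N); move=> /le_trans; apply.
by rewrite lerBlDr lerDl invr_ge0 addr_ge0// ltW.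
Qed.

Lemma psi_seq_cvgB {R : realType} (a : R) : 0 < a ->
  psi_seq a N - (a + N%:R)^-1 @[N --> \oo] --> psi a.
Proof.
move=> a0; rewrite -[X in _ --> X]subr0; apply: cvgB; first exact: psi_seq_cvg.
exact: cvg_invDn.
Qed.

Lemma psi_le {R : realType} (a : R) N : 0 < a -> psi a <= psi_seq a N.
Proof.
move=> a0; rewrite -(cvg_lim _ (psi_seq_cvg a a0))//.
apply: nonincreasing_cvgn_ge; first exact: psi_seq_decr.
by apply/cvg_ex; exists (psi a); exact: psi_seq_cvg.
Qed.

Lemma psi_ge {R : realType} (a : R) N : 0 < a -> psi_seq a N - (a + N%:R)^-1 <= psi a.
Proof.
move=> a0; rewrite -(cvg_lim _ (psi_seq_cvgB a a0))//.
apply: nondecreasing_cvgn_le; first exact: psi_seq_incr.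
by apply/cvg_ex; exists (psi a); exact: psi_seq_cvgB.
Qed.

Lemma psi_le_ln {R : realType} (a : R) : 0 < a -> psi a <= ln a.
Proof. by move=> a0; have := psi_le a 0 a0; rewrite /psi_seq big_nil addr0 subr0. Qed.

Lemma psi_ge_ln {R : realType} (a : R) : 0 < a -> ln a - a^-1 <= psi a.
Proof. by move=> a0; have := psi_ge a 0 a0; rewrite /psi_seq big_nil addr0 subr0. Qed.

Lemma psiS {R : realType} (a : R) : 0 < a -> psi (a + 1) = psi a + a^-1.
Proof.
move=> a0; have a1 : 0 < a + 1 by rewrite addr_gt0.
apply: (@cvg_unique _ _ (psi_seq (a + 1) @ \oo)) => //; first exact: psi_seq_cvg.
have -> : psi_seq (a + 1) = (fun N => psi_seq a N.+1 + a^-1).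
  apply/funext => N; rewrite /psi_seq [in RHS]big_nat_recl//= addr0.
  rewrite -natr1 -addrA [1 + _]addrC.
  rewrite [in RHS](eq_bigr (fun k => (a + 1 + k%:R)^-1)); last first.
    by move=> k _; rewrite -natr1 -addrA [1 + _]addrC.
  ring.
apply: cvgD; last exact: cvg_cst.
by rewrite (cvg_shiftS (psi_seq a)); exact: psi_seq_cvg.
Qed.

(** * The logarithmic derivative of Gamma *)

(** ln Gamma on the positive half-line. *)
HB.lock Definition lnGamma {R : realType} (z : R) : R := ln (euler_gamma z).

Lemma lnGammaS {R : realType} (z : R) : 0 < z -> lnGamma (z + 1) = ln z + lnGamma z.
Proof.
by move=> z0; rewrite lnGamma.unlock euler_gammaS// lnM ?posrE ?euler_gamma_gt0.
Qed.

Lemma lnGammaB_le_ln {R : realType} (z s : R) : 0 < z -> 0 <= s <= 1 ->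
  lnGamma (z + s) - lnGamma z <= s * ln z.
Proof.
move=> z0 s01; have /andP[s0 s1] := s01.
have zs0 : 0 < z + s by rewrite ltr_pwDl.
have := euler_gamma_wendel z s z0 s01.
rewrite -ler_ln ?posrE ?mulr_gt0 ?powR_gt0 ?euler_gamma_gt0//.
rewrite lnM ?posrE ?powR_gt0 ?euler_gamma_gt0// ln_powR lnGamma.unlock -lerBlDr; exact.
Qed.

(** Wendel's inequality with base point z + s and step 1 - s. *)
Lemma lnGammaB_ge_ln {R : realType} (z s : R) : 0 < z -> 0 <= s <= 1 ->
  s * (ln z - z^-1) <= lnGamma (z + s) - lnGamma z.
Proof.
move=> z0 s01; have /andP[s0 s1] := s01.
have zs0 : 0 < z + s by rewrite ltr_pwDl.
have s01' : 0 <= 1 - s <= 1 by apply/andP; split; lra.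
have := lnGammaB_le_ln (z + s) (1 - s) zs0 s01'.
have -> : z + s + (1 - s) = z + 1 by ring.
rewrite lnGammaS//.
have := lnB_le _ _ z0 zs0.
have -> : z + s - z = s by ring.
move=> h1.
have : (1 - s) * (ln (z + s) - ln z) <= 1 * (s / z).
  have [h|h] := leP 0 (ln (z + s) - ln z); last first.
    apply: (@le_trans _ _ 0); last by rewrite mul1r divr_ge0// ltW.
    by apply: mulr_ge0_le0; [lra|exact: ltW].
  by rewrite ler_pM//; lra.
have -> : s * (ln z - z^-1) = s * ln z - s / z by rewrite mulrBr.
nra.
Qed.

Lemma lnGammaDn {R : realType} (a : R) N : 0 < a ->
  lnGamma (a + N%:R) = lnGamma a + \sum_(0 <= k < N) ln (a + k%:R).
Proof.
move=> a0; elim: N => [|N ih]; first by rewrite big_nil !addr0.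
have aN : 0 < a + N%:R by rewrite ltr_pwDl.
rewrite big_nat_recr//= -natr1 addrA lnGammaS// ih.
by ring.
Qed.

(** The bound at a + N, carried back to a by the functional equation, for N
    tending to infinity. *)
Lemma lnGammaB_le_psi {R : realType} (a s : R) : 0 < a -> 0 <= s <= 1 ->
  lnGamma (a + s) - lnGamma a <= s * psi (a + s).
Proof.
move=> a0 s01; have /andP[s0 s1] := s01.
have as0 : 0 < a + s by rewrite ltr_pwDl.
have h N : lnGamma (a + s) - lnGamma a <= s * psi_seq (a + s) N.
  have aN : 0 < a + N%:R by rewrite ltr_pwDl.
  have asN : 0 < a + s + N%:R by rewrite ltr_pwDl.
  have := lnGammaB_le_ln _ _ aN s01.
  rewrite addrAC !lnGammaDn// /psi_seq mulrBr.
  have : s * (\sum_(0 <= k < N) (a + s + k%:R)^-1) <=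
    \sum_(0 <= k < N) ln (a + s + k%:R) - \sum_(0 <= k < N) ln (a + k%:R).
    rewrite -sumrB mulr_sumr; apply: ler_sum => k _.
    have ak : 0 < a + k%:R by rewrite ltr_pwDl.
    have ask : 0 < a + s + k%:R by rewrite ltr_pwDl.
    have := lnB_ge _ _ ak ask.
    by have -> : a + s + k%:R - (a + k%:R) = s by ring.
  have : s * ln (a + N%:R) <= s * ln (a + s + N%:R).
    by rewrite ler_wpM2l// ler_ln ?posrE// lerD2r lerDl.
  lra.
apply: (ler_cvg_to (cvg_cst _) (cvgM (cvg_cst s) (psi_seq_cvg _ as0))).
by near=> N; exact: h.
Unshelve. all: by end_near. Qed.

Lemma lnGammaB_ge_psi {R : realType} (a s : R) : 0 < a -> 0 <= s <= 1 ->
  s * psi a <= lnGamma (a + s) - lnGamma a.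
Proof.
move=> a0 s01; have /andP[s0 s1] := s01.
have as0 : 0 < a + s by rewrite ltr_pwDl.
have h N : s * (psi_seq a N - (a + N%:R)^-1) <= lnGamma (a + s) - lnGamma a.
  have aN : 0 < a + N%:R by rewrite ltr_pwDl.
  have := lnGammaB_ge_ln _ _ aN s01.
  rewrite addrAC !lnGammaDn// /psi_seq !mulrBr.
  have : \sum_(0 <= k < N) ln (a + s + k%:R) - \sum_(0 <= k < N) ln (a + k%:R) <=
     s * (\sum_(0 <= k < N) (a + k%:R)^-1).
    rewrite -sumrB mulr_sumr; apply: ler_sum => k _.
    have ak : 0 < a + k%:R by rewrite ltr_pwDl.
    have ask : 0 < a + s + k%:R by rewrite ltr_pwDl.
    have := lnB_le _ _ ak ask.
    by have -> : a + s + k%:R - (a + k%:R) = s by ring.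
  lra.
apply: (ler_cvg_to (cvgM (cvg_cst s) (psi_seq_cvgB _ a0)) (cvg_cst _)).
by near=> N; exact: h.
Unshelve. all: by end_near. Qed.

Lemma psi_seq_continuous {R : realType} (a : R) N : 0 < a ->
  {for a, continuous (psi_seq ^~ N)}.
Proof.
move=> a0; have aN k : 0 < a + k%:R by rewrite ltr_pwDl.
apply: cvgB.
  apply: continuous_comp; last exact: continuous_ln.
  by apply: cvgD; [exact: cvg_id|exact: cvg_cst].
elim: N => [|N ih].
  rewrite big_nil (_ : (fun x => _) = cst 0); first exact: cvg_cst.
  by apply/funext => x; rewrite big_nil.
rewrite big_nat_recr//= (_ : (fun x => _) =
  (fun x => \sum_(0 <= k < N) (x + k%:R)^-1 + (x + N%:R)^-1)).
  apply: cvgD => //; apply: cvgV; first by rewrite gt_eqF.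
  by apply: cvgD; [exact: cvg_id|exact: cvg_cst].
by apply/funext => x; rewrite big_nat_recr.
Qed.

(** Locally uniform limit: psi_seq a N is within 1/(a+N) <= 1/N of psi a. *)
Lemma psi_continuous {R : realType} (a : R) : 0 < a -> {for a, continuous (@psi R)}.
Proof.
move=> a0; apply/cvgrPdist_le => e e0.
have e4 : 0 < e / 4 by rewrite divr_gt0.
have [N N0] : exists N, (N%:R : R)^-1 <= e / 4 /\ (0 < N)%N.
  exists (Num.truncn (e / 4)^-1).+1; split => //.
  rewrite -[leRHS]invrK lef_pV2 ?posrE ?ltr0n ?invr_gt0//.
  exact/ltW/truncnS_gt.
case: N0 => N1 N0.
have b (x : R) : 0 < x -> `|psi x - psi_seq x N| <= e / 4.
  move=> x0; have := psi_le x N x0; have := psi_ge x N x0.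
  have : (x + N%:R)^-1 <= e / 4.
    apply: le_trans N1; rewrite lef_pV2 ?posrE ?ltr0n//; last by rewrite ltr_pwDl.
    by rewrite lerDr ltW.
  by move=> h1 h2 h3; rewrite ler_distl; apply/andP; split; lra.
have := psi_seq_continuous a N a0; move=> /cvgrPdist_le/(_ _ e4) h.
near=> x.
have x0 : 0 < x by near: x; exact: lt_nbhsr.
have h1 : `|psi_seq a N - psi_seq x N| <= e / 4 by near: x.
have := b _ a0; have := b _ x0; move: h1.
rewrite !ler_distl => /andP[? ?] /andP[? ?] /andP[? ?].
by apply/andP; split; lra.
Unshelve. all: by end_near. Qed.

(** The derivative as a limit of difference quotients without scaling. *)
Lemma is_derive_of_cvg {R : realType} (f : R -> R) (a d : R) :
  h^-1 * (f (h + a) - f a) @[h --> 0^'] --> d -> is_derive a 1 f d.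
Proof.
move=> H.
have E : (fun h : R => h^-1 *: (f (h *: (1:R) + a) - f a)) =
  (fun h => h^-1 * (f (h + a) - f a)).
  by apply/funext => h; rewrite [h *: (1:R)]mulr1.
split; first by rewrite /derivable E; apply/cvg_ex; exists d.
by rewrite /derive E; apply/cvg_lim.
Qed.

Lemma cvg_of_is_derive {R : realType} (f : R -> R) (a d : R) :
  is_derive a 1 f d -> h^-1 * (f (h + a) - f a) @[h --> 0^'] --> d.
Proof.
move=> [H <-].
have E : (fun h : R => h^-1 *: (f (h *: (1:R) + a) - f a)) =
  (fun h => h^-1 * (f (h + a) - f a)).
  by apply/funext => h; rewrite [h *: (1:R)]mulr1.
by move: H; rewrite /derivable /derive E.
Qed.

Lemma cvg_dnbhsDl {R : realType} (a : R) : (h + a) @[h --> 0^'] --> a.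
Proof.
rewrite -[X in _ --> X](add0r a); apply: cvgD; last exact: cvg_cst.
exact: nbhs_dnbhs.
Qed.

(** The difference quotient at a with step h lies between psi(a) and psi(a+h). *)
Lemma is_derive_lnGamma {R : realType} (a : R) : 0 < a ->
  is_derive a 1 (@lnGamma R) (psi a).
Proof.
move=> a0; apply: is_derive_of_cvg.
have c : psi (h + a) @[h --> 0^'] --> psi a.
  by apply: cvg_comp; [exact: cvg_dnbhsDl|exact: psi_continuous].
apply/cvgrPdist_le => e e0; move/cvgrPdist_le: c => /(_ _ e0) c.
near=> h.
have h0 : h != 0 by near: h; exact: nbhs_dnbhs_neq.
have ha : `|h| < a by near: h; apply: dnbhs0_lt.
have h1 : `|h| < 1 by near: h; apply: dnbhs0_lt.
have : `|psi a - psi (h + a)| <= e by near: h.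
apply: le_trans.
have [hp|hn] := ltP 0 h.
  have s01 : 0 <= h <= 1 by rewrite ltW//= ltW// (le_lt_trans (ler_norm _)).
  have := lnGammaB_ge_psi a h a0 s01; rewrite -ler_pdivlMl// => h2.
  have := lnGammaB_le_psi a h a0 s01; rewrite -ler_pdivrMl// => h3.
  rewrite [h + a]addrC distrC [leRHS]distrC !ger0_norm ?subr_ge0 ?lerD2r//.
  exact: le_trans h2 h3.
have hn' : 0 < - h by rewrite oppr_gt0 lt_neqAle h0.
have s01 : 0 <= - h <= 1 by rewrite oppr_ge0 hn -ler0_norm// ltW.
have ah : 0 < h + a by rewrite -ltrBlDl sub0r -ler0_norm.
have aE : h + a - h = a by ring.
have E : h^-1 * (lnGamma (h + a) - lnGamma a) = (- h)^-1 * (lnGamma a - lnGamma (h + a)).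
  by rewrite invrN; ring.
have := lnGammaB_ge_psi _ _ ah s01; rewrite -ler_pdivlMl// aE -E => h2.
have := lnGammaB_le_psi _ _ ah s01; rewrite -ler_pdivrMl// aE -E => h3.
rewrite !ger0_norm ?subr_ge0 ?lerD2l ?lerN2//.
exact: le_trans h2 h3.
Unshelve. all: by end_near. Qed.

(** * The reciprocal Gamma function *)

(** 1/Gamma on the whole line, equal to 0 at the poles of Gamma. *)
HB.lock Definition rgamma {R : realType} (z : R) : R := (Gamma z)^-1.

Lemma rgammaE {R : realType} (z : R) : 0 < z -> rgamma z = (euler_gamma z)^-1.
Proof. by move=> z0; rewrite rgamma.unlock /Gamma z0. Qed.

Lemma rgamma_gt0 {R : realType} (z : R) : 0 < z -> 0 < rgamma z.
Proof. by move=> z0; rewrite rgammaE// invr_gt0 euler_gamma_gt0. Qed.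

Lemma rgamma_expR {R : realType} (z : R) : 0 < z -> rgamma z = expR (- lnGamma z).
Proof.
by move=> z0; rewrite rgammaE// expRN lnGamma.unlock lnK// posrE euler_gamma_gt0.
Qed.

(** Holds for every real z, poles included. *)
Lemma rgammaS {R : realType} (z : R) : rgamma z = z * rgamma (z + 1).
Proof.
have [z0|z0] := ltP 0 z.
  by rewrite !rgammaE ?addr_gt0// euler_gammaS// invfM mulVKf ?gt_eqF.
rewrite rgamma.unlock /Gamma ltNge z0/=.
have [z1|z1] := ltP 0 (z + 1).
  rewrite (_ : Num.truncn (- z) = 0%N); last first.
    by apply: truncn_def; rewrite oppr_ge0 z0 -subr_gt0 opprK addrC.
  by rewrite big_ord1 addr0 invfM invrK mulrC.
(* For z <= -1 the product in the denominator gains exactly the factor z. *)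
have -> : Num.truncn (- z) = (Num.truncn (- (z + 1))).+1.
  apply: truncn_def; rewrite -!natr1.
  have /andP[h1 h2] : (Num.truncn (- (z + 1)))%:R <=
    - (z + 1) < (Num.truncn (- (z + 1))).+1%:R.
    by apply: truncn_itv; rewrite oppr_ge0.
  by move: h2; rewrite -natr1 => h2; apply/andP; split; lra.
rewrite [in LHS]big_ord_recl/= !invfM !invrK addr0 mulrCA; congr (_ * _).
rewrite -[X in euler_gamma (z + X)]natr1 -addrA [1 + _]addrC.
congr (_ * _); apply: eq_bigr => i _.
by rewrite /bump /= -natr1 -addrA [1 + _]addrC.
Qed.

Lemma rgamma_nat {R : realType} n : rgamma (n.+1%:R : R) = (n`!%:R)^-1.
Proof. by rewrite rgammaE// euler_gamma_nat. Qed.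

Lemma rgamma1 {R : realType} : rgamma (1 : R) = 1.
Proof. by rewrite rgammaE// euler_gamma1 invr1. Qed.

Lemma rgamma0 {R : realType} : rgamma (0 : R) = 0.
Proof. by rewrite rgammaS mul0r. Qed.

Lemma rgamma_half {R : realType} : rgamma (1 / 2 : R) = (Num.sqrt pi)^-1.
Proof. by rewrite rgammaE ?divr_gt0// euler_gamma_half. Qed.

Lemma is_derive_rgamma {R : realType} (a : R) : 0 < a ->
  is_derive a 1 (@rgamma R) (- psi a * rgamma a).
Proof.
move=> a0.
have h1 : is_derive a 1 (fun t => - lnGamma t : R) (- psi a).
  by apply: is_deriveN; exact: is_derive_lnGamma.
have h2 : is_derive a 1 (expR \o (fun t => - lnGamma t : R))
  (expR (- lnGamma a) * - psi a).
  exact: is_derive1_comp.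
rewrite rgamma_expR// mulrC.
apply: near_eq_is_derive h2; near=> t.
by rewrite /= rgamma_expR//; near: t; exact: lt_nbhsr.
Unshelve. all: by end_near. Qed.

Lemma expRB1_le {R : realType} (x : R) : `|expR x - 1| <= `|x| * expR `|x|.
Proof.
have [x0|x0] := leP 0 x.
  rewrite !ger0_norm ?subr_ge0 -?expR0 ?ler_expR//.
  have := expR_ge1Dx (- x).
  rewrite -(@ler_pM2r _ (expR x)) ?expR_gt0// -expRD addNr expR0; lra.
rewrite !ltr0_norm ?subr_lt0 ?expR_lt1//.
have := expR_ge1Dx x.
have : 1 <= expR (- x) by rewrite -expR0 ler_expR oppr_ge0 ltW.
nra.
Qed.

(** B only has to bound psi at the two ends, by lnGammaB_ge_psi and
    lnGammaB_le_psi. *)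
Lemma lnGammaB_abs {R : realType} (z s B : R) : 0 < z -> 0 < z + s -> `|s| <= 1 ->
  `|psi z| <= B -> `|psi (z + s)| <= B ->
  `|lnGamma (z + s) - lnGamma z| <= `|s| * B.
Proof.
move=> z0 zs0 s1; rewrite !ler_norml => /andP[b1 b2] /andP[b3 b4].
have [s0|s0] := leP 0 s.
  have s01 : 0 <= s <= 1 by rewrite s0 (le_trans (ler_norm _)).
  have := lnGammaB_ge_psi z s z0 s01; have := lnGammaB_le_psi z s z0 s01.
  rewrite ger0_norm// => h1 h2; apply/andP; split.
    by apply: le_trans h2; rewrite -mulrN ler_wpM2l.
  by apply: (le_trans h1); rewrite ler_wpM2l.
have s01 : 0 <= - s <= 1 by rewrite oppr_ge0 ltW//= -ltr0_norm.
have := lnGammaB_ge_psi _ _ zs0 s01; have := lnGammaB_le_psi _ _ zs0 s01.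
have -> : z + s - s = z by ring.
rewrite ltr0_norm// => h1 h2; apply/andP; split.
  rewrite -lerN2 opprK opprB (le_trans h1)// ler_wpM2l//; lra.
rewrite -lerN2 opprB; apply: le_trans h2; rewrite -mulrN ler_wpM2l//; lra.
Qed.

Lemma psi_abs {R : realType} (w : R) : 0 < w -> `|psi w| <= w + 2 / w.
Proof.
move=> w0; rewrite ler_norml; apply/andP; split; last first.
  apply: (le_trans (psi_le_ln w w0)); apply: (le_trans (ltW (ln_sublinear w0))).
  by rewrite lerDl divr_ge0// ltW.
have := psi_ge_ln w w0.
have := @ln_sublinear R w^-1; rewrite invr_gt0 => /(_ w0); rewrite lnV ?posrE//.
by lra.
Qed.

(** A Lipschitz bound in s for g(k+q+s), g = 1/Gamma, whose constant grows at
    most exponentially in k relative to g(k+q); this is the domination needed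
    to differentiate series with terms g(k+q). *)
Lemma rgammaB_bound {R : realType} (q s : R) (k : nat) :
  0 < q -> `|s| <= q / 2 -> `|s| <= 1 ->
  `|rgamma (k%:R + q + s) - rgamma (k%:R + q)| <= `|s| *
    (expR (2 * (k%:R + (q + 1 + 4 / q))) * rgamma (k%:R + q)).
Proof.
move=> q0 sq s1; set B := k%:R + (q + 1 + 4 / q); set z := k%:R + q.
have z0 : 0 < z by rewrite ltr_wpDl.
have qz : q <= z by rewrite lerDr.
have zs0 : q / 2 <= z + s.
  have := ler_norm (- s); rewrite normrN; lra.
have zs : 0 < z + s by apply: lt_le_trans zs0; rewrite divr_gt0.
(* B = k + q + 1 + 4/q dominates w + 2/w, hence psi, near z = k + q. *)
have Bz w : q / 2 <= w -> w <= z + 1 -> `|psi w| <= B.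
  move=> w1 w2; have w0 : 0 < w by apply: lt_le_trans w1; rewrite divr_gt0.
  apply: (le_trans (psi_abs w w0)).
  have : 2 / w <= 4 / q.
    by rewrite ler_pdivrMr// mulrAC ler_pdivlMr//; lra.
  by rewrite /B /z in w2 *; lra.
have h : `|lnGamma (z + s) - lnGamma z| <= `|s| * B.
  apply: lnGammaB_abs => //; apply: Bz => //; try lra.
  have := ler_norm s; lra.
have B0 : 0 <= B by rewrite /B addr_ge0// addr_ge0 ?divr_ge0 ?(ltW q0)// addr_ge0// ltW.
rewrite !rgamma_expR//.
have -> : expR (- lnGamma (z + s)) - expR (- lnGamma z) =
   (expR (- (lnGamma (z + s) - lnGamma z)) - 1) * expR (- lnGamma z).
  rewrite mulrBl -expRD mul1r; congr (expR _ - _); ring.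
rewrite normrM [X in _ * X]ger0_norm ?expR_ge0// mulrA ler_pM2r ?expR_gt0//.
apply: (le_trans (expRB1_le _)); rewrite normrN.
apply: (@le_trans _ _ ((`|s| * B) * expR B)).
  apply: ler_pM => //.
  by rewrite ler_expR (le_trans h)// -[leRHS]mul1r ler_wpM2r.
rewrite -mulrA ler_wpM2l// (_ : 2 * B = B + B); last by ring.
rewrite (expRD B B) ler_pM2r ?expR_gt0//.
by have := expR_ge1Dx B; lra.
Qed.

(** * Series *)

Lemma cvg_seriesS {R : realType} (u : nat -> R) (l : R) :
  series (fun k => u k.+1) @ \oo --> l -> series u @ \oo --> u 0%N + l.
Proof.
move=> h; rewrite -(cvg_shiftS (series u)).
rewrite (_ : (fun n => series u n.+1) = (fun n => u 0%N + series (fun k => u k.+1) n)).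
  by apply: cvgD => //; exact: cvg_cst.
by apply/funext => n; rewrite /series/= big_nat_recl.
Qed.

Lemma cvg_seriesZ {R : realType} (u : nat -> R) (c l : R) :
  series u @ \oo --> l -> series (fun k => c * u k) @ \oo --> c * l.
Proof.
move=> h; rewrite (_ : series _ = (fun n => c * series u n)).
  by apply: cvgM => //; exact: cvg_cst.
by apply/funext => n; rewrite /series/= mulr_sumr.
Qed.

Lemma cvg_seriesD {R : realType} (u v : nat -> R) (l m : R) :
  series u @ \oo --> l -> series v @ \oo --> m -> series (fun k => u k + v k) @ \oo -->
    l + m.
Proof.
move=> h1 h2; rewrite (_ : series _ = (fun n => series u n + series v n)).
  exact: cvgD.
by apply/funext => n; rewrite /series/= big_split.
Qed.

Lemma cvg_series_eq {R : realType} (u v : nat -> R) (l : R) : u =1 v ->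
  series u @ \oo --> l -> series v @ \oo --> l.
Proof. by move=> uv; rewrite (_ : v = u)//; apply/funext. Qed.

(** * The two-parameter series behind I and L *)

Lemma rgammaSn_le {R : realType} (p : R) k : 0 < p ->
  rgamma (k.+1%:R + p) <= rgamma (p + 1) / k`!%:R.
Proof.
move=> p0; elim: k => [|k ih]; first by rewrite fact0 divr1 addrC.
have kp : 0 < k.+1%:R + p by rewrite addr_gt0.
have E : rgamma (k.+2%:R + p) = rgamma (k.+1%:R + p) / (k.+1%:R + p).
  rewrite [in RHS]rgammaS -natr1 addrAC [RHS]mulrC mulrA mulVf ?mul1r// gt_eqF//.
rewrite E ler_pdivrMr// (le_trans ih)// factS natrM invfM.
have -> : rgamma (p + 1) * (k.+1%:R^-1 * k`!%:R^-1) * (k.+1%:R + p) =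
    rgamma (p + 1) / k`!%:R * (1 + p / k.+1%:R).
  have c0 : (k.+1%:R : R) != 0 by rewrite pnatr_eq0.
  have f0 : (k`!%:R : R) != 0 by rewrite pnatr_eq0 -lt0n fact_gt0.
  by move: c0 f0; move: (k.+1%:R : R) (k`!%:R : R) => c f c0 f0; field; rewrite c0 f0.
rewrite ler_peMr ?lerDl ?divr_ge0 ?(ltW p0)// ltW// rgamma_gt0// addr_gt0//.
Qed.

(** k-th term of Z(p,q) = sum_k y^k g(k+p) g(k+q), where g = 1/Gamma. *)
Definition gterm {R : realType} (y p q : R) (k : nat) : R :=
  y ^+ k * (rgamma (k%:R + p) * rgamma (k%:R + q)).

(** The sum Z(p,q); it converges for y >= 0 and all real p and q, see
    gterm_cvg. *)
HB.lock Definition gser {R : realType} (y p q : R) : R := limn (series (gterm y p q)).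

Lemma gterm_ge0 {R : realType} (y p q : R) k : 0 <= y -> 0 < p -> 0 < q ->
  0 <= gterm y p q k.
Proof.
by move=> y0 p0 q0; rewrite /gterm !mulr_ge0 ?exprn_ge0// ltW// rgamma_gt0// ltr_wpDl.
Qed.

Lemma gterm_cvg_pos {R : realType} (y p q : R) : 0 <= y -> 0 < p -> 0 < q ->
  cvgn (series (gterm y p q)).
Proof.
move=> y0 p0 q0.
suff /cvg_ex[l] : cvgn (series (fun k => gterm y p q k.+1)).
  by move=> /= /(cvg_seriesS (gterm y p q)) ?; apply/cvg_ex; eexists; eassumption.
pose c := y * (rgamma (p + 1) * rgamma (q + 1)).
have c0 : 0 <= c by rewrite !mulr_ge0// ltW// rgamma_gt0// addr_gt0.
apply: (@series_le_cvg _ _ (fun k => c * exp_coeff y k)).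
- by move=> k; exact: gterm_ge0.
- by move=> k; rewrite mulr_ge0// /exp_coeff/= divr_ge0 ?exprn_ge0.
- move=> k; rewrite /gterm exprS /c -!mulrA ler_wpM2l//.
  rewrite exp_coeffE /=.
  have -> : rgamma (p + 1) * (rgamma (q + 1) * (k`!%:R^-1 * y ^+ k)) =
      y ^+ k * (rgamma (p + 1) / k`!%:R * rgamma (q + 1)) by ring.
  rewrite ler_wpM2l ?exprn_ge0//; apply: ler_pM => //.
  + by rewrite ltW// rgamma_gt0// addr_gt0.
  + by rewrite ltW// rgamma_gt0// addr_gt0.
  + exact: rgammaSn_le.
  + apply: (le_trans (rgammaSn_le q k q0)).
    have r0 : 0 <= rgamma (q + 1) by rewrite ltW// rgamma_gt0// addr_gt0.
    by rewrite ler_piMr// invf_le1 ?ltr0n ?fact_gt0// ler1n fact_gt0.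
- by apply: is_cvg_seriesZ; exact: is_cvg_series_exp_coeff.
Qed.

(** A shift of the index makes both parameters positive. *)
Lemma gterm_cvg {R : realType} (y p q : R) : 0 <= y -> series (gterm y p q) @ \oo -->
  gser y p q.
Proof.
move=> y0; rewrite gser.unlock; suff : cvgn (series (gterm y p q)) by [].
(* p + N and q + N are positive. *)
pose N := (Num.truncn `|p| + Num.truncn `|q|).+1.
have hp : 0 < p + N%:R.
  have := truncnS_gt `|p|; have := ler_norm (- p); rewrite normrN.
  have : (Num.truncn `|p|).+1%:R <= (N%:R : R) by rewrite ler_nat ltnS leq_addr.
  lra.
have hq : 0 < q + N%:R.
  have := truncnS_gt `|q|; have := ler_norm (- q); rewrite normrN.
  have : (Num.truncn `|q|).+1%:R <= (N%:R : R) by rewrite ler_nat ltnS leq_addl.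
  lra.
move: N hp hq => N; elim: N p q => [|N ih] p q hp hq.
  by apply: gterm_cvg_pos => //; move: hp hq; rewrite !addr0.
suff /cvg_ex[l] : cvgn (series (fun k => gterm y p q k.+1)).
  by move=> /= /(cvg_seriesS (gterm y p q)) ?; apply/cvg_ex; eexists; eassumption.
have /cvg_ex[/= l h] : cvgn (series (gterm y (p + 1) (q + 1))).
  by apply: ih; [move: hp|move: hq]; rewrite -natr1 [N%:R + 1]addrC addrA.
apply/cvg_ex; exists (y * l).
apply: cvg_series_eq (cvg_seriesZ _ y _ h) => k.
by rewrite /gterm exprS -natr1 -!addrA ![1 + _]addrC mulrA.
Qed.

Lemma gser_shift {R : realType} (y p q : R) : 0 <= y ->
  gser y p q = rgamma p * rgamma q + y * gser y (p + 1) (q + 1).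
Proof.
move=> y0; apply: (@cvg_unique _ _ (series (gterm y p q) @ \oo)) => //;
  first exact: gterm_cvg.
have -> : rgamma p * rgamma q = gterm y p q 0 by rewrite /gterm expr0 mul1r !add0r.
apply: cvg_seriesS.
apply: cvg_series_eq (cvg_seriesZ _ y _ (gterm_cvg y (p + 1) (q + 1) y0)) => k.
by rewrite /gterm exprS -natr1 -!addrA ![1 + _]addrC mulrA.
Qed.

(** Compare coefficients, with g(k+q) = (k+q) g(k+q+1) and g(k+p-1) = (k+p-1)
    g(k+p). *)
Lemma gser_rec {R : realType} (y p q : R) : 0 <= y ->
  gser y p q = gser y (p - 1) (q + 1) + (q - p + 1) * gser y p (q + 1).
Proof.
move=> y0; apply: (@cvg_unique _ _ (series (gterm y p q) @ \oo)) => //;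
  first exact: gterm_cvg.
apply: cvg_series_eq (cvg_seriesD _ _ _ _ (gterm_cvg _ _ _ y0)
  (cvg_seriesZ _ (q - p + 1) _ (gterm_cvg _ _ _ y0))) => k.
rewrite /gterm (rgammaS (k%:R + (p - 1))) (rgammaS (k%:R + q)).
have -> : k%:R + (p - 1) + 1 = k%:R + p by ring.
have -> : k%:R + q + 1 = k%:R + (q + 1) by ring.
ring.
Qed.

(** * Differentiation of the series in a parameter *)

(** Tannery's theorem: dominated convergence for series. *)
Lemma tannery {R : realType} {T : topologicalType} {F : set_system T}
  {FF : ProperFilter F}
    (u : T -> nat -> R) (l M : nat -> R) :
  cvgn (series M) ->
  (\forall h \near F, forall k, `|u h k| <= M k) ->
  (forall k, u h k @[h --> F] --> l k) ->
  cvgn (series l) /\ limn (series (u h)) @[h --> F] --> limn (series l).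
Proof.
move=> cM uM ul.
have lM k : `|l k| <= M k.
  apply: (ler_cvg_to (cvg_norm (ul k)) (cvg_cst (M k))).
  by apply: filterS uM => h.
have M0 k : 0 <= M k by apply: le_trans (lM k).
have cvgdom (v : nat -> R) : (forall k, `|v k| <= M k) -> cvgn (series v).
  move=> vM; apply: normed_cvg; apply: (series_le_cvg _ _ vM cM) => // k.
have cl := cvgdom l lM; split => //.
apply/cvgrPdist_le => e e0.
have e4 : 0 < e / 4 by rewrite divr_gt0.
(* The tail beyond N contributes at most 2 (e/4), the first N terms at most e/4. *)
have [N hN] : exists N, limn (series M) - series M N <= e / 4.
  have /cvgrPdist_le/(_ _ e4)[N _ /(_ N (leqnn N))] := cM.
  by exists N; apply: le_trans (ler_norm _) _.
have nM : nondecreasing_seq (series M).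
  by apply/nondecreasing_seqP => n; rewrite /series/= big_nat_recr//= lerDl.
have cfin : (\sum_(0 <= k < N) `|l k - u h k|) @[h --> F] --> (0 : R).
  elim: N {hN} => [|n ih].
    by apply: cvg_near_eq (cvg_cst 0); near=> h; rewrite big_nil.
  rewrite -[X in _ --> X](addr0 (0 : R));
    apply: (cvg_near_eq (fun h => \sum_(0 <= k < n) `|l k - u h k| + `|l n - u h n|)).
    by near=> h; rewrite big_nat_recr.
  apply: cvgD => //; rewrite -(@normr0 R R); apply: cvg_norm.
  by rewrite -(subrr (l n)); apply: cvgB => //; exact: cvg_cst.
move/cvgrPdist_le: cfin => /(_ _ e4) cfin.
near=> h.
have uMh k : `|u h k| <= M k by move: k; near: h.
have : `|0 - \sum_(0 <= k < N) `|l k - u h k| | <= e / 4 by near: h.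
rewrite sub0r normrN ger0_norm ?sumr_ge0// => hfin.
have cu := cvgdom _ uMh.
apply: (ler_cvg_to (cvg_norm (cvgB cl cu)) (cvg_cst e)).
near=> n.
have Nn : (N <= n)%N by near: n; exact: nbhs_infty_ge.
rewrite -[X in `|X|]/(series l n - series (u h) n) /series/= -sumrB.
rewrite (le_trans (ler_norm_sum _ _ _))//.
rewrite (@big_cat_nat _ _ _ N)//=.
have : \sum_(N <= k < n) `|l k - u h k| <= \sum_(N <= k < n) (2 * M k).
  apply: ler_sum => k _; rewrite (le_trans (ler_normB _ _))//.
  by have := lM k; have := uMh k; lra.
rewrite -mulr_sumr.
have : series M n - series M N = \sum_(N <= k < n) M k.
  by rewrite /series/= (@big_cat_nat _ _ _ N 0 n)//= addrAC subrr add0r.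
have := nondecreasing_cvgn_le nM cM n.
by rewrite /series/= in hN *; lra.
Unshelve. all: by end_near. Qed.

(** Derivative of gterm with respect to its second parameter q. *)
Definition gterm_dq {R : realType} (y p q : R) (k : nat) : R :=
  y ^+ k * (rgamma (k%:R + p) * (- psi (k%:R + q) * rgamma (k%:R + q))).

Lemma is_derive_gser {R : realType} (y p q : R) : 0 <= y -> 0 < p -> 0 < q ->
  cvgn (series (gterm_dq y p q)) /\
  is_derive q 1 (gser y p) (limn (series (gterm_dq y p q))).
Proof.
move=> y0 p0 q0.
pose u h k := h^-1 * (gterm y p (h + q) k - gterm y p q k).
pose C := expR (2 * (q + 1 + 4 / q)).
have ul k : u h k @[h --> 0^'] --> gterm_dq y p q k.
  have kq : 0 < k%:R + q by rewrite ltr_wpDl.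
  have := cvg_of_is_derive _ _ _ (is_derive_rgamma _ kq) => H.
  have H2 : y ^+ k * rgamma (k%:R + p) * (h^-1 *
    (rgamma (h + (k%:R + q)) - rgamma (k%:R + q)))
      @[h --> 0^'] --> gterm_dq y p q k.
    by rewrite /gterm_dq mulrA; apply: cvgM H; exact: cvg_cst.
  apply: cvg_near_eq H2; near=> h.
  rewrite /u /gterm /= (_ : k%:R + (h + q) = h + (k%:R + q)); last by ring.
  by ring.
have cM : cvgn (series (fun k => C * gterm (y * expR 2) p q k)).
  by apply: is_cvg_seriesZ; apply: gterm_cvg_pos => //; rewrite mulr_ge0// expR_ge0.
have uM : \forall h \near 0^', forall k, `|u h k| <= C * gterm (y * expR 2) p q k.
  near=> h => k.
  have h0 : h != 0 by near: h; exact: nbhs_dnbhs_neq.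
  have h1 : `|h| <= 1 by apply: ltW; near: h; exact: dnbhs0_lt.
  have hq : `|h| <= q / 2 by apply: ltW; near: h; apply: dnbhs0_lt; rewrite divr_gt0.
  have := rgammaB_bound q h k q0 hq h1; set B := expR _ => HB.
  have -> : u h k = (y ^+ k * rgamma (k%:R + p)) *
    (h^-1 * (rgamma (k%:R + q + h) - rgamma (k%:R + q))).
    rewrite /u /gterm (_ : k%:R + q + h = k%:R + (h + q)); last by ring.
    by ring.
  have rp : 0 <= y ^+ k * rgamma (k%:R + p).
    by rewrite mulr_ge0 ?exprn_ge0// ltW// rgamma_gt0// ltr_wpDl.
  rewrite normrM ger0_norm//.
  have -> : C * gterm (y * expR 2) p q k = (y ^+ k * rgamma (k%:R + p)) *
    (B * rgamma (k%:R + q)).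
    have -> : B = C * expR 2 ^+ k by rewrite /B /C -expRM_natl -expRD; congr expR; ring.
    by rewrite /gterm exprMn; ring.
  rewrite ler_wpM2l// normrM normfV ler_pdivrMl ?normr_gt0//.
have [cl H] := @tannery R R 0^' _ u (gterm_dq y p q) _ cM uM ul.
split; first exact: cl.
apply: is_derive_of_cvg; apply: cvg_near_eq H; near=> h.
have h1 := gterm_cvg y p (h + q) y0; have h2 := gterm_cvg y p q y0.
apply/cvg_lim => //.
have := cvg_seriesZ _ h^-1 _ (cvg_seriesD _ _ _ _ h1 (cvg_seriesZ _ (-1) _ h2)).
rewrite mulN1r; apply: cvg_series_eq => k; rewrite /u; ring.
Unshelve. all: by end_near. Qed.

(** * The Bessel and Struve functions and their difference *)

Lemma powRDn {R : realType} (w s : R) n : 0 < w -> w `^ (s + n%:R) = w `^ s * w ^+ n.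
Proof. by move=> w0; rewrite powRD ?(gt_eqF w0) ?implybT// powR_mulrn// ltW. Qed.

Lemma gser_sym {R : realType} (y p q : R) : gser y p q = gser y q p.
Proof.
by rewrite gser.unlock; congr (limn (series _)); apply/funext => k;
  rewrite /gterm [rgamma _ * _]mulrC.
Qed.

Lemma rgamma_natD1 {R : realType} k : rgamma (k%:R + 1 : R) = (k`!%:R)^-1.
Proof. by rewrite natr1 rgamma_nat. Qed.

Lemma besselIE {R : realType} (nu x : R) : 0 < x ->
  besselI nu x = (x / 2) `^ nu * gser ((x / 2) ^+ 2) 1 (nu + 1).
Proof.
move=> x0; have w0 : 0 < x / 2 by rewrite divr_gt0.
rewrite /besselI; apply/cvg_lim => //.
apply: cvg_series_eq (cvg_seriesZ _ ((x / 2) `^ nu) _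
  (gterm_cvg ((x / 2) ^+ 2) 1 (nu + 1) _)) => [k|]; last first.
  by rewrite exprn_ge0// ltW.
rewrite /gterm powRD ?(gt_eqF w0) ?implybT// powR_mulrn ?ltW// -exprM rgamma_natD1 addrA.
rewrite invfM rgamma.unlock; ring.
Qed.

Lemma struveLE {R : realType} (nu x : R) : 0 < x ->
  struveL nu x = (x / 2) `^ (nu + 1) * gser ((x / 2) ^+ 2) (3 / 2) (nu + 3 / 2).
Proof.
move=> x0; have w0 : 0 < x / 2 by rewrite divr_gt0.
rewrite /struveL; apply/cvg_lim => //.
apply: cvg_series_eq (cvg_seriesZ _ ((x / 2) `^ (nu + 1)) _
  (gterm_cvg ((x / 2) ^+ 2) (3 / 2) (nu + 3 / 2) _)) => [k|]; last first.
  by rewrite exprn_ge0// ltW.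
rewrite /gterm (_ : (2 * k)%:R + nu + 1 = nu + 1 + (2 * k)%:R); last by ring.
rewrite powRDn// exprM addrA.
rewrite invfM rgamma.unlock; ring.
Qed.

(** The difference I_(nu-1/2)(x) - L_(1/2-nu)(x). *)
Definition bsDiff {R : realType} (x nu : R) : R :=
  besselI (nu - 1 / 2) x - struveL (1 / 2 - nu) x.

Lemma bsDiffE {R : realType} (x nu : R) : 0 < x ->
  bsDiff x nu = (x / 2) `^ (nu - 1 / 2) * gser ((x / 2) ^+ 2) 1 (nu + 1 / 2) -
    (x / 2) `^ (3 / 2 - nu) * gser ((x / 2) ^+ 2) (3 / 2) (2 - nu).
Proof.
move=> x0; rewrite /bsDiff besselIE// struveLE//.
congr (_ `^ _ * gser _ _ _ - _ `^ _ * gser _ _ _); by field.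
Qed.

Lemma bsDiff_rec {R : realType} (x nu : R) : 0 < x ->
  bsDiff x (nu + 1) = bsDiff x (nu - 1) - (2 * nu - 1) / x * bsDiff x nu -
    (x / 2) `^ (1 / 2 - nu) * rgamma (1 / 2) * rgamma (2 - nu).
Proof.
move=> x0; have w0 : 0 < x / 2 by rewrite divr_gt0.
have y0 : 0 <= (x / 2) ^+ 2 by rewrite exprn_ge0// ltW.
rewrite !bsDiffE//.
set y := (x / 2) ^+ 2.
have -> : nu + 1 + 1 / 2 = nu + 1 / 2 + 1 by ring.
have -> : nu - 1 + 1 / 2 = nu - 1 / 2 by field.
rewrite (gser_rec y 1 (nu - 1 / 2))// (gser_shift y (1 - 1))// subrr rgamma0 mul0r !add0r.
rewrite (_ : nu - 1 / 2 + 1 = nu + 1 / 2); last by field.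
have -> : 2 - (nu + 1) = 1 - nu by ring.
have -> : 2 - (nu - 1) = 2 - nu + 1 by ring.
rewrite (gser_rec y (3 / 2) (1 - nu))// (gser_shift y (3 / 2 - 1))//.
have -> : (3 / 2 - 1 : R) = 1 / 2 by field.
have -> : (1 / 2 + 1 : R) = 3 / 2 by field.
have -> : 1 - nu + 1 = 2 - nu by ring.
set G3 := gser y 1 _; set G2 := gser y 1 _.
set H3 := gser y (3 / 2) _; set H2 := gser y (3 / 2) _.
have -> : nu + 1 - 1 / 2 = (nu - 1 - 1 / 2) + 2%:R by ring.
have -> : nu - 1 / 2 = (nu - 1 - 1 / 2) + 1%:R by ring.
have -> : 3 / 2 - (nu + 1) = 1 / 2 - nu by field.
have -> : 3 / 2 - (nu - 1) = 1 / 2 - nu + 2%:R by field.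
have -> : 3 / 2 - nu = 1 / 2 - nu + 1%:R by field.
rewrite !powRDn//.
set a := _ `^ _; set b := _ `^ _.
by rewrite /y; field; rewrite gt_eqF.
Qed.

(** * Derivatives and quotients at a common zero *)

Lemma is_derive_affine {R : realType} (f : R -> R) (a c t d : R) :
  is_derive (a + c * t) 1 f d -> is_derive t 1 (fun t => f (a + c * t)) (c * d).
Proof.
move=> H.
have h1 : is_derive t 1 (fun t : R => a + c * t) c.
  apply: is_derive_of_cvg; apply: cvg_near_eq (cvg_cst c); near=> h.
  have h0 : h != 0 by near: h; exact: nbhs_dnbhs_neq.
  by field.
by rewrite mulrC; exact: (@is_derive1_comp R f (fun t : R => a + c * t) t d c H h1).
Unshelve. all: by end_near. Qed.

Lemma is_derive_powRr {R : realType} (w c t : R) : 0 < w ->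
  is_derive t 1 (fun t => w `^ (c * t)) (c * ln w * w `^ (c * t)).
Proof.
move=> w0.
have E (s : R) : w `^ s = expR (s * ln w) by rewrite /powR gt_eqF.
have h := is_derive_affine expR 0 (c * ln w) t _ (is_derive_expR _).
rewrite add0r in h.
rewrite E (_ : c * t * ln w = c * ln w * t); last by ring.
apply: near_eq_is_derive h; near=> s.
by rewrite E add0r; congr expR; ring.
Unshelve. all: by end_near. Qed.

(** k-th term of the derivative at h = 0 of w^h Z(1,b+h) - w^-h Z(b,1-h) when
    y = w^2 and L = 2 ln w. *)
Definition dterm {R : realType} (y b L : R) (k : nat) : R :=
  y ^+ k * (rgamma (k%:R + 1) * rgamma (k%:R + b)) *
    (L - psi (k%:R + b) - psi (k%:R + 1)).

(** The function of h vanishes at 0 by symmetry of Z, so its derivative there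
    decides the limits for n = 1 and n = 2. *)
Lemma is_derive_gserB {R : realType} (w b : R) : 0 < w -> 0 < b ->
  let y := w ^+ 2 in
  cvgn (series (dterm y b (2 * ln w))) /\
  is_derive (0:R) (1:R) (fun h : R => w `^ h * gser y 1 (b + h) - w `^ (- h) *
    gser y b (1 - h))
    (limn (series (dterm y b (2 * ln w)))).
Proof.
move=> w0 b0 y.
have y0 : 0 <= y by rewrite exprn_ge0// ltW.
have [c1 d1] := is_derive_gser y 1 b y0 ltr01 b0.
have [c2 d2] := is_derive_gser y b 1 y0 b0 ltr01.
have c3 := gterm_cvg y 1 b y0.
set D1 := limn _ in d1; set D2 := limn _ in d2.
have c : series (dterm y b (2 * ln w)) @ \oo --> (2 * ln w) * gser y 1 b + (D1 + D2).
  apply: cvg_series_eq (cvg_seriesD _ _ _ _ (cvg_seriesZ _ (2 * ln w) _ c3)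
    (cvg_seriesD _ _ _ _ c1 c2)) => k.
  by rewrite /dterm /gterm /gterm_dq; ring.
split; first by apply/cvg_ex; eexists; exact: c.
have -> : limn (series (dterm y b (2 * ln w))) = (2 * ln w) * gser y 1 b + (D1 + D2).
  by apply/cvg_lim => //; exact: c.
have e1 : is_derive (0:R) (1:R) (fun h : R => gser y 1 (b + 1 * h)) (1 * D1).
  by apply: is_derive_affine; rewrite mulr0 addr0.
have e2 : is_derive (0:R) (1:R) (fun h : R => gser y b (1 + (-1) * h)) ((-1) * D2).
  by apply: is_derive_affine; rewrite mulr0 addr0.
have p1 := is_derive_powRr w 1 0 w0.
have p2 := is_derive_powRr w (-1) 0 w0.
have H := is_deriveB (is_deriveM p1 e1) (is_deriveM p2 e2).
apply: is_derive_eq.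
  apply: near_eq_is_derive H; near=> h.
  by rewrite /= !fctE !mulN1r !mul1r.
rewrite !mulr0 powRr0 !addr0 (gser_sym y b 1).
rewrite /GRing.scale/=; ring.
Unshelve. all: by end_near. Qed.

(** Punctured limits at a from punctured limits at 0. *)
Lemma dnbhs_shift {R : realType} (f : R -> R) (a l : R) :
  f (h + a) @[h --> 0^'] --> l -> f h @[h --> a^'] --> l.
Proof.
move/cvgr_dnbhsP => H; apply/cvgr_dnbhsP => u [ua cu].
have := H (fun n => u n - a).
rewrite (_ : (fun n => f (u n - a + a)) = (fun n => f (u n)));
  last by apply/funext => n; rewrite subrK.
apply; split; first by move=> n; rewrite subr_eq0.
by rewrite -(subrr a); apply: cvgB => //; exact: cvg_cst.
Qed.

Lemma sin_piDn {R : realType} (t : R) n :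
  sin (pi * (t + n%:R)) = (-1) ^+ n * sin (pi * t).
Proof.
elim: n => [|n ih]; first by rewrite addr0 mul1r.
rewrite -natr1 addrA mulrDr mulr1 exprS mulN1r mulNr -ih.
by rewrite sinD cospi sinpi mulr0 addr0 mulrN1.
Qed.

Lemma cvg_sin_pi {R : realType} : h^-1 * sin (pi * h) @[h --> (0:R)^'] --> (pi : R).
Proof.
have h := is_derive_affine sin 0 pi (0:R) _ (is_derive_sin _).
have := cvg_of_is_derive _ _ _ h.
rewrite mulr0 addr0 cos0 mulr1 sin0; apply: cvg_near_eq; near=> t.
by rewrite subr0 addr0 add0r.
Unshelve. all: by end_near. Qed.

(** Quotient of a function with a zero at 0 by the sine, translated by n. *)
Lemma cvg_div_sin {R : realType} (f : R -> R) (d : R) (n : nat) :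
  h^-1 * f h @[h --> 0^'] --> d ->
  f h / sin (pi * (h + n%:R)) @[h --> 0^'] --> (-1) ^+ n * d / pi.
Proof.
move=> H.
have E : (h^-1 * f h) * ((-1) ^+ n * (h^-1 * sin (pi * h))^-1) @[h --> 0^'] -->
  d * ((-1) ^+ n * pi^-1).
  apply: cvgM => //; apply: cvgM; first exact: cvg_cst.
  by apply: cvgV; [rewrite gt_eqF ?pi_gt0|exact: cvg_sin_pi].
rewrite -mulrA mulrCA; apply: cvg_near_eq E; near=> h.
have h0 : h != 0 by near: h; exact: nbhs_dnbhs_neq.
rewrite sin_piDn !invfM invrK.
have -> : ((-1) ^+ n : R)^-1 = (-1) ^+ n by rewrite -exprVn invrN1.
by move: (sin (pi * h))^-1 => s; field.
Unshelve. all: by end_near. Qed.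

Lemma cvg_dnbhs_derive {R : realType} (f : R -> R) (a d : R) :
  is_derive a 1 f d -> f h @[h --> a^'] --> f a.
Proof.
move=> H; have c : {for a, continuous f}.
  by apply: differentiable_continuous; apply/derivable1_diffP; case: H.
by apply: cvg_trans c => A; apply: nbhs_dnbhs.
Qed.

Lemma cvg_rgamma1B {R : realType} : rgamma (1 - h) @[h --> (0:R)^'] --> (1 : R).
Proof.
have d : is_derive (0:R) (1:R) (fun h : R => rgamma (1 + -1 * h))
  (-1 * (- psi 1 * rgamma 1)).
  by apply: is_derive_affine; rewrite mulr0 addr0; exact: is_derive_rgamma.
have := cvg_dnbhs_derive _ _ _ d; rewrite mulr0 addr0 rgamma1.
by apply: cvg_near_eq; near=> h; rewrite mulN1r.
Unshelve. all: by end_near. Qed.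

(** 1/Gamma at -m and the sine have simple zeros; the ratio follows from m = 0
    by the functional equations. *)
Lemma cvg_rgamma_sin {R : realType} (m : nat) :
  rgamma (- (h + m%:R)) / sin (pi * (h + m%:R)) @[h --> (0:R)^'] --> - m`!%:R / (pi : R).
Proof.
elim: m => [|m ih].
  have -> : - 0`!%:R / pi = (-1) ^+ 0 * (- 1) / pi :> R by rewrite fact0 expr0 mul1r.
  apply: (@cvg_div_sin _ (fun h => rgamma (- (h + 0%:R))) _ 0).
  apply: cvg_near_eq (cvgN (@cvg_rgamma1B R)); near=> h.
  have h0 : h != 0 by near: h; exact: nbhs_dnbhs_neq.
  rewrite addr0 [in RHS]rgammaS (_ : - h + 1 = 1 - h); last by ring.
  by field.
have c : h + m%:R + 1 @[h --> (0:R)^'] --> (m.+1%:R : R).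
  rewrite -natr1; apply: cvgD; [exact: cvg_dnbhsDl|exact: cvg_cst].
have -> : - m.+1`!%:R / pi = m.+1%:R * (- m`!%:R / pi) :> R by rewrite factS natrM; ring.
apply: cvg_near_eq (cvgM c ih); near=> h.
rewrite /= -natr1 addrA.
have := sin_piDn (h + m%:R) 1; rewrite expr1 mulN1r => ->.
rewrite [in RHS]rgammaS (_ : - (h + m%:R + 1) + 1 = - (h + m%:R)); last by ring.
by rewrite invrN; ring.
Unshelve. all: by end_near. Qed.

(** * The exponential generating series of the digamma values *)

Lemma series_expR {R : realType} (x : R) :
  series (fun k => k`!%:R^-1 * x ^+ k) @ \oo --> expR x.
Proof. by rewrite -exp_coeffE; exact: is_cvg_series_exp_coeff. Qed.

(** Coefficients of sum_k psi(k+1) t^k/k!. *)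
Definition psi_coef {R : realType} (k : nat) : R := psi (k.+1%:R) / k`!%:R.

(** The entire function K(t) = sum_k psi(k+1) t^k/k!. *)
HB.lock Definition psiser {R : realType} (x : R) : R := limn (pseries psi_coef x).

(** Domination by the exponential series at 2|x|. *)
Lemma cvg_pseries_fact {R : realType} (f : nat -> R) (x : R) :
  (forall k, `|f k| <= 3 * 2 ^+ k / k`!%:R) -> cvgn (pseries f x).
Proof.
move=> hf; apply: normed_cvg.
apply: (@series_le_cvg _ _ (fun k => 3 * (k`!%:R^-1 * (2 * `|x|) ^+ k))).
- by move=> k; rewrite /= normr_ge0.
- by move=> k; rewrite mulr_ge0// mulr_ge0 ?invr_ge0// exprn_ge0// mulr_ge0.
- move=> k /=; rewrite normrM normrX exprMn.
  apply: (@le_trans _ _ (3 * 2 ^+ k / k`!%:R * `|x| ^+ k)).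
    by rewrite ler_wpM2r// exprn_ge0.
  by rewrite le_eqVlt; apply/orP; left; apply/eqP; ring.
- apply: is_cvg_seriesZ; apply/cvg_ex; eexists; exact: series_expR.
Qed.

Lemma psi_coef_bound {R : realType} k : `|psi_coef k : R| <= 3 * 2 ^+ k / k`!%:R.
Proof.
rewrite /psi_coef normrM [`|_^-1|]ger0_norm ?invr_ge0// ler_wpM2r ?invr_ge0//.
apply: (le_trans (psi_abs (k.+1%:R : R) (ltr0Sn _ _))).
apply: (@le_trans _ _ (k.+3%:R : R)).
  rewrite -(natr1 k.+2) -(natr1 k.+1) -addrA lerD2l.
  by rewrite ler_pdivrMr// -[leLHS]mulr1 ler_pM// ler1n.
elim: k => [|k ih]; first by rewrite mulr1.
rewrite exprS mulrCA -natr1.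
have : (1:R) <= k.+3%:R by rewrite ler1n.
lra.
Qed.

Lemma psiser_cvg {R : realType} (x : R) :
  series (fun k => psi_coef k * x ^+ k) @ \oo --> psiser x.
Proof. rewrite psiser.unlock; exact: (cvg_pseries_fact _ x (@psi_coef_bound R)). Qed.

Lemma inv_factS_le {R : realType} (k : nat) : (k.+1`!%:R)^-1 <= (k`!%:R)^-1 :> R.
Proof. by rewrite lef_pV2 ?posrE ?ltr0n ?fact_gt0// ler_nat factS leq_pmull. Qed.

Lemma inv_fact_le_pow2 {R : realType} (k : nat) : (k`!%:R)^-1 <= 3 * 2 ^+ k / k`!%:R :> R.
Proof.
rewrite ler_peMl ?invr_ge0//.
rewrite (@le_trans _ _ (1 * 1))//; first by rewrite mulr1.
by rewrite ler_pM// ?ler1n// exprn_ege1// ler1n.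
Qed.

Lemma expRB1_series {R : realType} (x : R) : x != 0 ->
  series (fun k => k.+1`!%:R^-1 * x ^+ k) @ \oo --> (expR x - 1) / x.
Proof.
move=> x0.
have /cvg_ex[/= l h] : cvgn (pseries (fun k => k.+1`!%:R^-1) x).
  apply: cvg_pseries_fact => k; rewrite ger0_norm ?invr_ge0//.
  exact: le_trans (inv_factS_le k) (inv_fact_le_pow2 k).
have -> : (expR x - 1) / x = l; last exact: h.
have h3 : series (fun k => k.+1`!%:R^-1 * x ^+ k.+1) @ \oo --> x * l.
  by apply: cvg_series_eq (cvg_seriesZ _ x _ h) => k; rewrite exprS mulrCA.
have := cvg_seriesS (fun k => k`!%:R^-1 * x ^+ k) _ h3.
rewrite /= fact0 invr1 mulr1 => h2.
by rewrite (cvg_unique _ (series_expR x) h2)//; field.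
Qed.

(** From psi(k+2) = psi(k+1) + 1/(k+1), the termwise derivative of K is K(x) +
    sum_k x^k/(k+1)!. *)
Lemma psiser_derivative {R : realType} (x : R) :
  derivable psiser x 1 /\ (x != 0 -> is_derive x 1 psiser (psiser x + (expR x - 1) / x)).
Proof.
pose e k : R := k.+1`!%:R^-1.
have f0 k : (k`!%:R : R) != 0 by rewrite pnatr_eq0 -lt0n fact_gt0.
have s0 k : (k.+1%:R : R) != 0 by rewrite pnatr_eq0.
have dk : pseries_diffs psi_coef = (fun k => psi_coef k + e k).
  apply/funext => k; rewrite /pseries_diffs /psi_coef /e factS natrM -(natr1 k.+1) psiS//.
  by move: (f0 k) (s0 k); move: (k.+1%:R : R) (k`!%:R : R) => a b ha hb; field;
    rewrite ha hb.
have ddk : pseries_diffs (pseries_diffs psi_coef) =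
  (fun k => psi_coef k + e k + k.+1%:R * e k.+1).
  rewrite dk; apply/funext => k; rewrite {1}/pseries_diffs mulrDr.
  by have := congr1 (@^~ k) dk; rewrite /pseries_diffs => ->.
have ce y : cvgn (pseries e y).
  apply: cvg_pseries_fact => k; rewrite ger0_norm ?invr_ge0//.
  exact: le_trans (inv_factS_le k) (inv_fact_le_pow2 k).
have cde y : cvgn (pseries (fun k => k.+1%:R * e k.+1) y).
  apply: cvg_pseries_fact => k; rewrite ger0_norm ?mulr_ge0 ?invr_ge0//.
  apply: le_trans (inv_fact_le_pow2 k); apply: le_trans (inv_factS_le k).
  rewrite /e factS natrM invfM mulrA ler_piMl ?invr_ge0//.
  by rewrite ler_pdivrMr// mul1r ler_nat.
have ck (y : R) : cvgn (pseries psi_coef y) by apply: cvg_pseries_fact;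
  exact: psi_coef_bound.
have cD (f g : nat -> R) y : cvgn (pseries f y) -> cvgn (pseries g y) ->
    cvgn (pseries (fun k => f k + g k) y).
  move=> /cvg_ex[/= a ca] /cvg_ex[/= b cb]; apply/cvg_ex; exists (a + b).
  by apply: cvg_series_eq (cvg_seriesD _ _ _ _ ca cb) => k; rewrite /= mulrDl.
have xK : `|x| < `|(`|x| + 1)|.
  by rewrite [ltRHS]ger0_norm ?addr_ge0// ltrDl.
have H := @pseries_snd_diffs R psi_coef (`|x| + 1) x (ck _) _ _ xK.
have {}H : is_derive x 1 psiser (limn (pseries (pseries_diffs psi_coef) x)).
  have -> : @psiser R = (fun x => limn (pseries psi_coef x)).
    by apply/funext => t; rewrite psiser.unlock.
  apply: H; first by rewrite dk; apply: cD; [exact: ck|exact: ce].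
  rewrite ddk; apply: (cD (fun k => psi_coef k + e k)); last exact: cde.
  by apply: cD; [exact: ck|exact: ce].
split; first by case: H.
move=> x0; have -> : psiser x + (expR x - 1) / x =
  limn (pseries (pseries_diffs psi_coef) x).
  apply/esym/cvg_lim => //; rewrite dk.
  by apply: cvg_series_eq (cvg_seriesD _ _ _ _ (psiser_cvg x) (expRB1_series x x0)) =>
    k; rewrite /= mulrDl.
exact: H.
Qed.

(** M(t) = e^-t K(t), an antiderivative of (1 - e^-t)/t. *)
Definition psiM {R : realType} (t : R) : R := expR (- t) * psiser t.

Lemma is_derive_psiM {R : realType} (t : R) : t != 0 ->
  is_derive t 1 psiM ((1 - expR (- t)) / t).
Proof.
move=> t0.
have h1 : is_derive t 1 (fun t : R => expR (- t)) (expR (- t) * -1).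
  exact: (@is_derive1_comp _ expR -%R).
have h2 := (psiser_derivative t).2 t0.
have := is_deriveM h1 h2; rewrite /GRing.scale/= => H.
have -> : (1 - expR (- t)) / t = expR (- t) * (psiser t + (expR t - 1) / t) +
    psiser t * (expR (- t) * -1); last exact: H.
rewrite expRN; have := expR_gt0 t; move: (expR t) => E E0; field.
by rewrite t0 gt_eqF.
Qed.

Lemma psiM_continuous0 {R : realType} : {for (0:R), continuous (@psiM R)}.
Proof.
apply: cvgM; first by apply: continuous_comp; [exact: cvgN|exact: continuous_expR].
apply: differentiable_continuous; apply/derivable1_diffP; exact: (psiser_derivative 0).1.
Qed.

Lemma is_derive_lnBpsiM {R : realType} (t : R) : 0 < t ->
  is_derive t 1 (fun t => ln t - psiM t) (expR (- t) / t).
Proof.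
move=> t0.
have h1 := is_derive1_ln t0.
have h2 : is_derive t 1 psiM ((1 - expR (- t)) / t) by apply: is_derive_psiM;
  rewrite gt_eqF.
have -> : expR (- t) / t = t^-1 - (1 - expR (- t)) / t by field; rewrite gt_eqF.
exact: (is_deriveB h1 h2).
Qed.

Lemma is_derive_lnNBpsiM {R : realType} (t : R) : t < 0 ->
  is_derive t 1 (fun t => ln (- t) - psiM t) (expR (- t) / t).
Proof.
move=> t0; have t1 : 0 < - t by rewrite oppr_gt0.
have h1 : is_derive t 1 (fun t : R => ln (- t)) ((- t)^-1 * -1).
  by apply: (@is_derive1_comp _ (@ln R) -%R); exact: is_derive1_ln.
have h2 : is_derive t 1 psiM ((1 - expR (- t)) / t) by apply: is_derive_psiM;
  rewrite lt_eqF.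
have -> : expR (- t) / t = (- t)^-1 * -1 - (1 - expR (- t)) / t.
  by rewrite invrN; field; rewrite lt_eqF.
exact: (is_deriveB h1 h2).
Qed.

Lemma expR_psiM {R : realType} (y : R) : expR y * psiM y = psiser y.
Proof. by rewrite /psiM mulrA -expRD subrr expR0 mul1r. Qed.

(** Under the Poisson weights e^-y y^k/k!, use psi(k+1) >= ln(k+1) - 1/(k+1)
    and the tangent bound ln(k+1) >= ln y + 1 - y/(k+1). *)
Lemma psiM_ge {R : realType} (y : R) : 0 < y -> ln y - y^-1 <= psiM y.
Proof.
move=> y0; rewrite -(@ler_pM2l _ (expR y)) ?expR_gt0// expR_psiM.
have y1 : y != 0 by rewrite gt_eqF.
have h1 := cvg_seriesZ _ (ln y + 1) _ (series_expR y).
have h2 := cvg_seriesZ _ (- (y + 1)) _ (expRB1_series y y1).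
apply: (@le_trans _ _ ((ln y + 1) * expR y + - (y + 1) * ((expR y - 1) / y))).
  rewrite -subr_ge0 (_ : _ - _ = 1 + y^-1); last by field.
  by rewrite addr_ge0// invr_ge0 ltW.
apply: (ler_cvg_to (cvg_seriesD _ _ _ _ h1 h2) (psiser_cvg y)).
near=> n; apply: ler_sum => k _.
rewrite /psi_coef factS natrM invfM.
have k0 : 0 < (k.+1%:R : R) by [].
have := psi_ge_ln _ k0; have := lnB_ge _ _ y0 k0.
have f0 : 0 <= (k`!%:R : R)^-1 * y ^+ k by rewrite mulr_ge0 ?invr_ge0// exprn_ge0// ltW.
move: (k.+1%:R : R) k0 => s k0.
rewrite (_ : (s - y) / s = 1 - y / s); last by field; rewrite gt_eqF.
move=> h3 h4.
rewrite (_ : _ + _ = (ln y + 1 - (y + 1) / s) * (k`!%:R^-1 * y ^+ k)); last by ring.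
rewrite (_ : psi s / _ * _ = psi s * (k`!%:R^-1 * y ^+ k)); last by ring.
by apply: ler_wpM2r => //; rewrite mulrDl mul1r; lra.
Unshelve. all: by end_near. Qed.

Lemma series_natM_exp {R : realType} (y : R) :
  series (fun k => k%:R * (k`!%:R^-1 * y ^+ k)) @ \oo --> y * expR y.
Proof.
have := cvg_seriesS (fun k => k%:R * (k`!%:R^-1 * y ^+ k)) (y * expR y).
rewrite /= mul0r add0r; apply.
apply: cvg_series_eq (cvg_seriesZ _ y _ (series_expR y)) => k.
rewrite factS natrM invfM exprS -!mulrA mulVKf ?pnatr_eq0//; ring.
Qed.

(** Under the Poisson weights e^-y y^k/k!, use psi(k+1) <= ln(k+1) and the
    tangent of the logarithm at y+1. *)
Lemma psiM_le {R : realType} (y : R) : 0 < y -> psiM y <= ln (y + 1).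
Proof.
move=> y0; rewrite -(@ler_pM2l _ (expR y)) ?expR_gt0// expR_psiM.
have y1 : 0 < y + 1 by rewrite addr_gt0.
have h1 := cvg_seriesZ _ (ln (y + 1) - y / (y + 1)) _ (series_expR y).
have h2 := cvg_seriesZ _ ((y + 1)^-1) _ (series_natM_exp y).
have -> : expR y * ln (y + 1) =
   (ln (y + 1) - y / (y + 1)) * expR y + (y + 1)^-1 * (y * expR y) by ring.
apply: (ler_cvg_to (psiser_cvg y) (cvg_seriesD _ _ _ _ h1 h2)).
near=> n; apply: ler_sum => k _.
rewrite /psi_coef.
have k0 : 0 < (k.+1%:R : R) by [].
have := psi_le_ln _ k0; have := lnB_le _ _ y1 k0.
have f0 : 0 <= (k`!%:R : R)^-1 * y ^+ k by rewrite mulr_ge0 ?invr_ge0// exprn_ge0// ltW.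
rewrite -natr1; move: (k%:R : R) => s.
rewrite (_ : (s + 1 - (y + 1)) / (y + 1) = s / (y + 1) - y / (y + 1)); last first.
  by rewrite -mulrBl; congr (_ / _); ring.
move=> h3 h4.
rewrite (_ : psi (s + 1) / _ * _ = psi (s + 1) * (k`!%:R^-1 * y ^+ k)); last by ring.
rewrite [leRHS](_ : _ = (ln (y + 1) - y / (y + 1) + s / (y + 1)) *
  (k`!%:R^-1 * y ^+ k)); last by ring.
by apply: ler_wpM2r => //; lra.
Unshelve. all: by end_near. Qed.

(** This fixes the constant of integration in the exponential integral. *)
Lemma cvg_lnBpsiM {R : realType} : (ln y - psiM y : R) @[y --> +oo] --> (0 : R).
Proof.
have c : (y : R)^-1 @[y --> +oo] --> (0:R)
  by apply/gtr0_cvgV0; [near=> y; near: y; exact: nbhs_pinfty_gt|exact: cvg_id].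
apply: (@squeeze_cvgr _ _ _ _ (fun y => - y^-1) (fun y => y^-1)).
- near=> y.
  have y0 : 0 < y by near: y; exact: nbhs_pinfty_gt.
  have y1 : 0 < y + 1 by rewrite addr_gt0.
  have := psiM_ge y y0; have := psiM_le y y0; have := lnB_le _ _ y0 y1.
  rewrite (_ : (y + 1 - y) / y = y^-1); last by field; rewrite gt_eqF.
  by move=> h1 h2 h3; apply/andP; split; lra.
- by rewrite -oppr0; apply: cvgN.
- exact: c.
Unshelve. all: by end_near. Qed.

(** * The exponential integral *)

Lemma expRN_div_continuous {R : realType} (t : R) : t != 0 ->
  {for t, continuous (fun t : R => expR (- t) / t)}.
Proof.
move=> t0; apply: cvgM; last exact: cvgV.
by apply: continuous_comp; [exact: cvgN|exact: continuous_expR].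
Qed.

Lemma integral_expRN_div {R : realType} (a : R) : 0 < a ->
  \int[@lebesgue_measure R]_(t in `[a, +oo[) (expR (- t) / t) = psiM a - ln a.
Proof.
move=> a0.
rewrite (@Rintegral_ge0_continuous_FTC2y _ _ (fun t => ln t - psiM t) a 0).
- by ring.
- by move=> t at0; rewrite divr_ge0 ?expR_ge0// (le_trans (ltW a0)).
- apply: continuous_in_subspaceT => t; rewrite inE/= in_itv/= andbT => h.
  by apply: expRN_div_continuous; rewrite gt_eqF// (lt_le_trans a0).
- exact: cvg_lnBpsiM.
- by move=> t at0; have [] := is_derive_lnBpsiM t (lt_trans a0 at0).
- apply: cvg_at_right_filter.
  have : {for a, continuous (fun t => ln t - psiM t)}; last by [].
  apply: differentiable_continuous; apply/derivable1_diffP.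
  by have [] := is_derive_lnBpsiM a a0.
- move=> t; rewrite in_itv/= andbT => at0; rewrite derive1E.
  by have [_ ->] := is_derive_lnBpsiM t (lt_trans a0 at0).
Qed.

(** The interval [a, b] lies on the negative half-line, where ln(-t) - M(t) is
    the antiderivative. *)
Lemma integral_expRN_div_neg {R : realType} (a b : R) : a < b -> b < 0 ->
  \int[@lebesgue_measure R]_(t in `[a, b]) (expR (- t) / t) =
  (ln (- b) - psiM b) - (ln (- a) - psiM a).
Proof.
move=> ab b0.
have neg t : t <= b -> t < 0 by move=> tb; apply: le_lt_trans b0.
have d (t : R) : t <= b -> derivable (fun t : R => ln (- t) - psiM t) t 1.
  by move=> tb; have [] := is_derive_lnNBpsiM t (neg _ tb).
have c (t : R) : t <= b -> {for t, continuous (fun t : R => ln (- t) - psiM t)}.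
  by move=> tb; apply: differentiable_continuous; apply/derivable1_diffP; exact: d.
rewrite /Rintegral (@continuous_FTC2 _ _ (fun t => ln (- t) - psiM t) a b)//.
- apply: continuous_in_subspaceT => t; rewrite inE/= in_itv/= => /andP[_ h].
  by apply: expRN_div_continuous; rewrite lt_eqF// neg.
- split.
  + by move=> t; rewrite in_itv/= => /andP[_ /ltW]; exact: d.
  + by apply: cvg_at_right_filter; apply: c; exact: ltW.
  + by apply: cvg_at_left_filter; exact: c.
- move=> t; rewrite in_itv/= => /andP[_ /ltW tb]; rewrite derive1E.
  by have [_ ->] := is_derive_lnNBpsiM t (neg _ tb).
Qed.

Lemma EiN {R : realType} (x : R) : 0 < x -> Ei (- x) = ln x - psiM x.
Proof.
move=> x0; rewrite /Ei oppr_gt0 ltNge (ltW x0)/= opprK integral_expRN_div//; ring.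
Qed.

(** Principal value: the logarithms at the ends -e and e cancel and M is
    continuous at 0. *)
Lemma EiE {R : realType} (x : R) : 0 < x -> Ei x = ln x - psiM (- x).
Proof.
move=> x0; rewrite /Ei x0.
have c : psiM e - psiM (- e) + (psiM (- x) - ln x) @[e --> 0^'+] --> psiM (- x) - ln x.
  rewrite -[X in _ --> X]add0r; apply: cvgD; last exact: cvg_cst.
  rewrite -[X in _ --> X](subrr (psiM (0:R))); apply: cvg_at_right_filter; apply: cvgB.
    exact: psiM_continuous0.
  have h : {for (0:R), continuous (@psiM R \o -%R)}.
    apply: continuous_comp; first exact: (cvgN cvg_id).
    by rewrite oppr0; exact: psiM_continuous0.
  have e : psiM (0:R) = (@psiM R \o -%R) 0 by rewrite /= oppr0.
  rewrite [X in _ --> X]e; exact: h.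
rewrite (_ : lim _ = psiM (- x) - ln x); first by ring.
apply/cvg_lim => //; apply: cvg_near_eq c; near=> e.
have e0 : 0 < e by near: e; exact: nbhs_right_gt.
have ex : e < x by near: e; exact: nbhs_right_lt.
rewrite integral_expRN_div// integral_expRN_div_neg ?ltrN2 ?oppr_lt0// !opprK.
ring.
Unshelve. all: by end_near. Qed.

(** * The recursion for the closed form *)

(** Pascal's rule gives T(m+1) = T(m+1)/2 + T(m) for the sum T(m) on the left. *)
Lemma sum_bin_pow2 {R : realType} (m : nat) :
  \sum_(0 <= j < m.+1) 'C(m + j, m)%:R / 2 ^+ j = 2 ^+ m :> R.
Proof.
elim: m => [|m ih]; first by rewrite big_nat1 bin0 expr0 divr1.
set T := \sum_(0 <= j < m.+2) _.
have h : T = T / 2 + 2 ^+ m.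
  have E1 : T = \sum_(0 <= j < m.+2) 'C(m + j, m.+1)%:R / 2 ^+ j +
               \sum_(0 <= j < m.+2) 'C(m + j, m)%:R / 2 ^+ j :> R.
    by rewrite /T -big_split; apply: eq_bigr => j _ /=; rewrite addSn binS natrD mulrDl.
  rewrite {1}E1 [X in _ + X]big_nat_recr//= ih [X in X + _]big_nat_recl//=
    addn0 bin_small// mul0r add0r.
  have E2 : \sum_(0 <= i < m.+1) 'C(m + i.+1, m.+1)%:R / 2 ^+ i.+1 =
      (T - 'C(m.+1 + m.+1, m.+1)%:R / 2 ^+ m.+1) / 2 :> R.
    rewrite /T [in RHS]big_nat_recr//= addrK big_distrl/=; apply: eq_bigr => i _.
    by rewrite addnS addSn exprSr invfM mulrA.
  rewrite E2.
  have -> : 'C(m.+1 + m.+1, m.+1) = (2 * 'C(m + m.+1, m))%N.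
    by rewrite addSn binS mul2n -addnn; congr addn; rewrite -bin_sub ?leq_addl// addnK.
  rewrite natrM -mulrA; move: ('C(m + m.+1, m)%:R / 2 ^+ m.+1 : R) (2 ^+ m : R) => c q.
  by field.
have -> : T = 2 * (T - T / 2) by field.
by rewrite {1}h addrAC subrr add0r exprS.
Qed.

(** Coefficient of the bracket B_(i+1) in the n-th closed form; indices are
    shifted so that i starts at 0. *)
Definition wcoef {R : realType} (n i : nat) : R :=
  'C(2 * n - i - 2, n - 1)%:R * (2 ^+ i.+1 / 4 ^+ n / i`!%:R).

Lemma sum_wcoef_fact {R : realType} (m : nat) :
  \sum_(0 <= i < m.+1) wcoef m.+1 i * i`!%:R = 1 / 2 :> R.
Proof.
transitivity (\sum_(0 <= i < m.+1) 'C(m + (m - i), m)%:R / 2 ^+ (m - i) *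
  (2 ^+ m.+1 / 4 ^+ m.+1) : R).
  rewrite !big_nat; apply: eq_bigr => i /= im.
  rewrite /wcoef (_ : (2 * m.+1 - i - 2 = m + (m - i))%N); last by lia.
  rewrite subn1 /=.
  have -> : (2 ^+ m.+1 : R) = 2 ^+ (m - i) * 2 ^+ i.+1 by rewrite -exprD;
    congr (_ ^+ _); lia.
  have f0 : (i`!%:R : R) != 0 by rewrite pnatr_eq0 -lt0n fact_gt0.
  have p0 : (2 ^+ (m - i) : R) != 0 by rewrite expf_neq0.
  move: f0 p0; move: (4 ^+ m.+1 : R)^-1 (2 ^+ i.+1 : R) => d e.
  move: ('C(m + (m - i), m)%:R : R) (i`!%:R : R) (2 ^+ (m - i) : R) => c f p f0 p0.
  by field; rewrite f0 p0.
rewrite -mulr_suml big_nat_rev/= add0n.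
rewrite (eq_big_nat _ _ (F2 := fun j => 'C(m + j, m)%:R / 2 ^+ j)); last first.
  by move=> j /= jm; rewrite subSS subKn.
rewrite sum_bin_pow2 (_ : (4 : R) = 2 * 2); last by ring.
rewrite exprMn !exprS; have p0 : (2 ^+ m : R) != 0 by rewrite expf_neq0.
by move: p0; move: (2 ^+ m : R) => p p0; field.
Qed.

Lemma bin_three_term {R : realType} (m i N : nat) : (i + N = 2 * m + 2)%N ->
  (m.+2%:R * m.+1%:R * 'C(N.+2, m.+2)%:R =
   2 * m.+1%:R * (2 * m + 3)%:R * 'C(N, m.+1)%:R + i%:R * (i%:R - 1) * 'C(N, m)%:R :> R).
Proof.
move=> iN.
have h1 : (m.+2%:R * 'C(N.+2, m.+2)%:R = N.+2%:R * 'C(N.+1, m.+1)%:R :> R).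
  by rewrite -!natrM (mul_bin_diag N.+2).
have h2 : (m.+1%:R * 'C(N.+1, m.+1)%:R = N.+1%:R * 'C(N, m)%:R :> R).
  by rewrite -!natrM (mul_bin_diag N.+1).
have h3 : (m.+1%:R * 'C(N, m.+1)%:R = (N%:R - m%:R) * 'C(N, m)%:R :> R).
  rewrite -natrM mul_bin_left natrM; have [mN|Nm] := leqP m N; first by rewrite natrB.
  by rewrite bin_small// !mulr0.
have iE : i%:R = 2 * m%:R + 2 - N%:R :> R.
  by apply/eqP; rewrite eq_sym subr_eq -natrD iN natrD natrM.
have -> : m.+2%:R * m.+1%:R * 'C(N.+2, m.+2)%:R = m.+1%:R *
  (m.+2%:R * 'C(N.+2, m.+2)%:R) :> R by ring.
rewrite h1 mulrCA h2.
have -> : 2 * m.+1%:R * (2 * m + 3)%:R * 'C(N, m.+1)%:R = 2 * (2 * m + 3)%:R *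
  (m.+1%:R * 'C(N, m.+1)%:R) :> R by ring.
rewrite h3 iE natrD natrM -!natr1; ring.
Qed.

Lemma wcoef_rec {R : realType} (m i : nat) : (i <= m.+2)%N ->
  4 * m.+2%:R * m.+1%:R * wcoef m.+3 i =
  2 * m.+1%:R * (2 * m + 3)%:R * wcoef m.+2 i +
  i%:R * (i%:R - 1) * 'C(2 * m + 2 - i, m)%:R * (2 ^+ i.+1 / 4 ^+ m.+2 / i`!%:R) :> R.
Proof.
move=> im; rewrite /wcoef !subn1 /=.
have -> : (2 * m.+3 - i - 2 = (2 * m + 2 - i).+2)%N by lia.
have -> : (2 * m.+2 - i - 2 = 2 * m + 2 - i)%N by lia.
have := @bin_three_term R m i (2 * m + 2 - i) _.
rewrite subnKC; last by lia.
move=> /(_ erefl).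
rewrite [4 ^+ m.+3]exprS invfM.
move: (4 ^+ m.+2 : R)^-1 (2 ^+ i.+1 : R) ((i`!%:R)^-1 : R) => d e f.
move: ('C(_, m.+2)%:R : R) ('C(_, m.+1)%:R : R) ('C(_, m)%:R : R) (m.+2%:R : R)
  (m.+1%:R : R) ((2 * m + 3)%:R : R) (i%:R : R) => A B C M2 M1 M3 I h.
have -> : 4 * M2 * M1 * (A * (e * (4^-1 * d) * f)) = (M2 * M1 * A) * (e * d * f) by field.
rewrite h; ring.
Qed.

(** The three-term recursion for the sums. The sequence b stands for the
    brackets B_(i+1), of which only the two-step relation is used. *)
Lemma sum_wcoef_rec {R : realType} (m : nat) (b : nat -> R) (x : R) :
  (forall i, b i.+2 = x ^+ 2 * b i - 2 * i`!%:R * x) ->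
  4 * m.+2%:R * m.+1%:R * \sum_(0 <= i < m.+3) wcoef m.+3 i * b i =
  2 * m.+1%:R * (2 * m + 3)%:R * \sum_(0 <= i < m.+2) wcoef m.+2 i * b i +
  x ^+ 2 * \sum_(0 <= i < m.+1) wcoef m.+1 i * b i - x.
Proof.
move=> bE.
(* g i is the coefficient of b i contributed by x^2 times the (m+1)-st sum: it
   vanishes for i = 0, 1, and g (i+2) = wcoef (m+1) i. *)
pose g i : R := i%:R * (i%:R - 1) * 'C(2 * m + 2 - i, m)%:R *
  (2 ^+ i.+1 / 4 ^+ m.+2 / i`!%:R).
have gE i : (i <= m)%N -> g i.+2 = wcoef m.+1 i.
  move=> im; rewrite /g /wcoef.
  have -> : (2 * m + 2 - i.+2 = 2 * m.+1 - i - 2)%N by lia.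
  rewrite subn1 /= !factS !natrM (exprS 4 m.+1) (exprS 2 i.+2) (exprS 2 i.+1).
  have f0 : (i`!%:R : R) != 0 by rewrite pnatr_eq0 -lt0n fact_gt0.
  have p0 : (4 ^+ m.+1 : R) != 0 by rewrite expf_neq0.
  have i1 : (i.+1%:R : R) != 0 by rewrite pnatr_eq0.
  have i2 : (i.+2%:R : R) != 0 by rewrite pnatr_eq0.
  have iE : (i.+2%:R - 1 : R) = i.+1%:R by rewrite -natr1 addrK.
  rewrite iE; move: f0 p0 i1 i2.
  move: (i`!%:R : R) (4 ^+ m.+1 : R) (i.+1%:R : R) (i.+2%:R : R) (2 ^+ i.+1 : R)
    ('C(_, m)%:R : R) => f p a c e B f0 p0 a0 c0.
  by field; rewrite f0 p0 a0 c0.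
rewrite mulr_sumr.
rewrite (eq_big_nat _ _ (F2 := fun i => 2 * m.+1%:R * (2 * m + 3)%:R *
  (wcoef m.+2 i * b i) + g i * b i)); last first.
  by move=> i /= im; rewrite mulrA wcoef_rec // mulrDl -/(g i) mulrA.
rewrite big_split/= -mulr_sumr [X in _ * X + _ = _]big_nat_recr//=.
have -> : wcoef m.+2 m.+2 = 0 :> R.
  rewrite /wcoef (_ : (2 * m.+2 - m.+2 - 2 = m)%N); last by lia.
  by rewrite subn1/= bin_small// mul0r.
rewrite mul0r addr0 -addrA; congr (_ + _).
rewrite big_nat_recl// big_nat_recl//=.
rewrite {1 2}/g !mul0r add0r subrr mulr0 !mul0r add0r.
rewrite (eq_big_nat _ _ (F2 := fun i => x ^+ 2 * (wcoef m.+1 i * b i) - 2 * x *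
  (wcoef m.+1 i * i`!%:R))); last first.
  by move=> i /= im; rewrite gE// bE; ring.
rewrite sumrB -!mulr_sumr sum_wcoef_fact; congr (_ - _); by field.
Qed.

(** The coefficient with integer powers of 2 and indices starting at 1. *)
Lemma wcoefE {R : realType} (n k : nat) : (0 < k <= n)%N ->
  'C(2 * n - k - 1, n - 1)%:R * ((2 : R) ^ (k%:Z - (2 * n)%:Z) / ((k - 1)`!)%:R) =
    wcoef n (k - 1).
Proof.
move=> /andP[k0 kn]; rewrite /wcoef.
have -> : (2 * n - k - 1 = 2 * n - (k - 1) - 2)%N by lia.
congr (_ * (_ / _)).
rewrite expfzDr// -exprnN -!exprnP; congr (_ / _); first by congr (_ ^+ _); lia.
by rewrite exprM; congr (_ ^+ _); ring.
Qed.

(** * Duplication formulas *)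

(** Even and odd parts of a series, from the series and its alternating
    companion. *)
Lemma cvg_series_parity {R : realType} (u : nat -> R) (A B : R) :
  series u @ \oo --> A -> series (fun k => (-1) ^+ k * u k) @ \oo --> B ->
  series (fun k => u (2 * k)%N) @ \oo --> (A + B) / 2 /\
  series (fun k => u (2 * k).+1) @ \oo --> (A - B) / 2.
Proof.
move=> hA hB.
have sub (v : nat -> R) (l : R) : series v @ \oo --> l ->
  series v (2 * n)%N @[n --> \oo] --> l.
  move=> h; apply: (cvg_comp (fun n => (2 * n)%N) (series v) _ h) => S [N _ NS].
  by exists N => // n /= Nn; apply: NS; rewrite /= (leq_trans Nn)// leq_pmull.
have m1 (k : nat) : (-1 : R) ^+ (2 * k) = 1 by rewrite exprM sqrrN !expr1n.
split.
- have h := sub _ _ (cvg_seriesZ _ (1 / 2) _ (cvg_seriesD _ _ _ _ hA hB)).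
  have -> : (A + B) / 2 = 1 / 2 * (A + B) by ring.
  apply: cvg_near_eq h; near=> n; rewrite /series/=.
  elim: (n : nat) => [|j ih]; first by rewrite !big_nil.
  rewrite [in RHS]big_nat_recr//= mulnS add2n big_nat_recr// big_nat_recr// ih.
  by rewrite /= exprS m1; field.
- have h := sub _ _ (cvg_seriesZ _ (1 / 2) _
  (cvg_seriesD _ _ _ _ hA (cvg_seriesZ _ (-1) _ hB))).
  have -> : (A - B) / 2 = 1 / 2 * (A + -1 * B) by ring.
  apply: cvg_near_eq h; near=> n; rewrite /series/=.
  elim: (n : nat) => [|j ih]; first by rewrite !big_nil.
  rewrite [in RHS]big_nat_recr//= mulnS add2n big_nat_recr// big_nat_recr// ih.
  by rewrite /= exprS m1; field.
Unshelve. all: by end_near. Qed.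

(** Legendre's duplication formula at the integers. *)
Lemma rgamma_duplication {R : realType} (k : nat) :
  rgamma (k%:R + 1) * rgamma (k%:R + 3 / 2) =
    2 ^+ (2 * k).+1 / (2 * k).+1`!%:R / Num.sqrt pi :> R.
Proof.
have s0 : Num.sqrt pi != 0 :> R by rewrite gt_eqF// sqrtr_gt0 pi_gt0.
elim: k => [|k ih].
  rewrite !add0r rgamma1 mul1r muln0 factS fact0 muln1 expr1 divr1.
  have := @rgamma_half R; rewrite rgammaS (_ : 1 / 2 + 1 = 3 / 2); last by field.
  by move=> <-; field.
have n0 : 0 <= k%:R :> R by [].
have e1 : k.+1%:R + 1 = k%:R + 1 + 1 :> R by rewrite -(natr1 k).
have e2 : k.+1%:R + 3 / 2 = k%:R + 3 / 2 + 1 :> R by rewrite -(natr1 k); ring.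
move: ih; rewrite (rgammaS (k%:R + 1)) (rgammaS (k%:R + 3 / 2)) e1 e2.
rewrite mulnS add2n (factS (2 * k).+2) (factS (2 * k).+1).
have : (0 < (2 * k).+1`!)%N by rewrite fact_gt0.
move: ((2 * k).+1`!)%N => F F0; rewrite !natrM.
have -> : (2 * k).+3%:R = 2 * (k%:R + 3 / 2) :> R by rewrite -!natr1 natrM; field.
have -> : (2 * k).+2%:R = 2 * (k%:R + 1) :> R by rewrite -!natr1 natrM; field.
rewrite [2 ^+ (2 * k).+3]exprS [2 ^+ (2 * k).+2]exprS.
have f0 : (F%:R : R) != 0 by rewrite pnatr_eq0 -lt0n.
have k1 : k%:R + 1 != 0 :> R by rewrite gt_eqF//; lra.
have k2 : k%:R + 3 / 2 != 0 :> R by rewrite gt_eqF//; lra.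
move: f0 k1 k2 s0.
move: (F%:R : R) (k%:R + 1 : R) (k%:R + 3 / 2 : R) (2 ^+ (2 * k).+1 : R) => f a b p.
move: (Num.sqrt pi : R) (rgamma (a + 1)) (rgamma (b + 1)) => s r1 r2 f0 a0 b0 s0 ih.
apply: (mulfI (mulf_neq0 a0 b0)).
rewrite (_ : a * b * (r1 * r2) = a * r1 * (b * r2)); last by ring.
by rewrite ih; field; rewrite s0 f0 a0 b0.
Qed.

(** The digamma function at k + 3/2, k + 1 and 2k + 2. *)
Lemma psi_duplication {R : realType} (k : nat) :
  psi (k%:R + 3 / 2) + psi (k%:R + 1) = 2 * psi ((2 * k).+2%:R) - 2 * ln 2 :> R.
Proof.
(* d is constant by psiS, and d N tends to - 2 ln 2 by the logarithmic bounds. *)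
pose d (N : nat) : R := psi (N%:R + 1 / 2) + psi (N%:R + 1) - 2 * psi (2 * N%:R + 1).
have dS N : d N.+1 = d N.
  rewrite /d -(natr1 N).
  have n0 : 0 <= N%:R :> R by [].
  move: (N%:R : R) n0 => a a0.
  have h1 : 0 < a + 1 / 2 by lra.
  have h2 : 0 < a + 1 by lra.
  have h3 : 0 < 2 * a + 1 by lra.
  have -> : a + 1 + 1 / 2 = a + 1 / 2 + 1 by ring.
  have -> : 2 * (a + 1) + 1 = 2 * a + 1 + 1 + 1 by ring.
  rewrite (psiS (a + 1 / 2))// (psiS (a + 1))// (psiS (2 * a + 1 + 1))
    ?(psiS (2 * a + 1))//; last by lra.
  have -> : (2 * a + 1)^-1 = (a + 1 / 2)^-1 / 2 by field; rewrite !gt_eqF//; lra.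
  have -> : (2 * a + 1 + 1)^-1 = (a + 1)^-1 / 2 by field; rewrite !gt_eqF//; lra.
  by move: (a + 1 / 2)^-1 (a + 1)^-1 => u v; field.
have d0 N : d N = d 0%N by elim: N => // N ih; rewrite dS.
have dE : d 0%N = - (2 * ln 2).
  apply: (@cvg_unique _ _ ((fun N : nat => d N) @ \oo)) => //.
    by rewrite (_ : (fun N : nat => d N) = cst (d 0%N)); [exact: cvg_cst|apply/funext].
  have c : 4 * ((1/2 + N%:R)^-1 : R) @[N --> \oo] --> (0 : R).
    rewrite -[X in _ --> X](mulr0 4); apply: cvgM; first exact: cvg_cst.
    exact: (cvg_invDn (1/2)).
  apply: (@squeeze_cvgr _ _ _ _ (fun N => - (2 * ln 2) - 4 * (1/2 + N%:R)^-1)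
    (fun N => - (2 * ln 2) + 4 * (1/2 + N%:R)^-1)); last 2 first.
  - by rewrite -[X in _ --> X]subr0; apply: cvgB => //; exact: cvg_cst.
  - by rewrite -[X in _ --> X]addr0; apply: cvgD => //; exact: cvg_cst.
  near=> N.
  have n0 : 0 <= N%:R :> R by [].
  rewrite /d; move: (N%:R : R) n0 => a a0.
  have a1 : 0 < a + 1 / 2 by lra.
  have a2 : 0 < a + 1 by lra.
  have a3 : 0 < 2 * a + 1 by lra.
  have := psi_le_ln _ a1; have := psi_ge_ln _ a1.
  have := psi_le_ln _ a2; have := psi_ge_ln _ a2.
  have := psi_le_ln _ a3; have := psi_ge_ln _ a3.
  have E : ln (2 * a + 1) = ln 2 + ln (a + 1 / 2).
    by rewrite -lnM ?posrE//; congr (ln _); field.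
  have := lnB_le _ _ a1 a2; have := lnB_ge _ _ a1 a2; rewrite E.
  have -> : (a + 1 - (a + 1 / 2)) = 1 / 2 by field.
  have i3 : (2 * a + 1)^-1 = (1 / 2 + a)^-1 / 2 by field; rewrite !gt_eqF//; lra.
  have i2 : (a + 1)^-1 <= (1 / 2 + a)^-1 by rewrite lef_pV2 ?posrE//; lra.
  have i20 : 0 < (a + 1)^-1 by rewrite invr_gt0.
  rewrite i3 [a + 1 / 2]addrC; move: i2 i20; move: ((a + 1)^-1) ((1 / 2 + a)^-1) => u v.
  by move=> *; apply/andP; split; lra.
have := d0 k; rewrite dE /d.
have -> : (2 * k).+2%:R = 2 * k%:R + 1 + 1 :> R by rewrite -(natr1 (2 * k).+1)
  -(natr1 (2 * k)) natrM.
have n0 : 0 <= k%:R :> R by [].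
move: (k%:R : R) n0 => a a0.
have h1 : 0 < a + 1 / 2 by lra.
have h3 : 0 < 2 * a + 1 by lra.
have -> : a + 3 / 2 = a + 1 / 2 + 1 by field.
rewrite (psiS (a + 1 / 2))// (psiS (2 * a + 1))//.
have -> : (2 * a + 1)^-1 = (a + 1 / 2)^-1 / 2 by field; rewrite !gt_eqF//; lra.
lra.
Unshelve. all: by end_near. Qed.

(** * The derivative series at n = 1 and n = 2 *)

(** k-th term of the expansion of e^x Ei(-x), for x > 0. *)
Definition ei_term {R : realType} (x : R) (k : nat) : R :=
  x ^+ k / k`!%:R * (ln x - psi (k.+1%:R)).

Lemma ei_term_cvg {R : realType} (x : R) : 0 < x ->
  series (ei_term x) @ \oo --> expR x * Ei (- x) /\
  series (fun k => (-1) ^+ k * ei_term x k) @ \oo --> expR (- x) * Ei x.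
Proof.
move=> x0; rewrite EiN// EiE// !mulrBr !expR_psiM.
split.
- have := cvg_seriesD _ _ _ _ (cvg_seriesZ _ (ln x) _ (series_expR x))
  (cvg_seriesZ _ (-1) _ (psiser_cvg x)).
  rewrite mulN1r [ln x * _]mulrC; apply: cvg_series_eq => k.
  by rewrite /ei_term /psi_coef; ring.
- have := cvg_seriesD _ _ _ _ (cvg_seriesZ _ (ln x) _ (series_expR (- x)))
  (cvg_seriesZ _ (-1) _ (psiser_cvg (- x))).
  rewrite mulN1r [ln x * _]mulrC; apply: cvg_series_eq => k.
  by rewrite /ei_term /psi_coef [(- x) ^+ k]exprNn; ring.
Qed.

Lemma dterm_three_half {R : realType} (x : R) : 0 < x ->
  series (dterm ((x / 2) ^+ 2) (3 / 2) (2 * ln (x / 2))) @ \oo -->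
  2 / (Num.sqrt pi * x) * (expR x * Ei (- x) - expR (- x) * Ei x).
Proof.
move=> x0; have [hA hB] := ei_term_cvg x x0.
have s0 : Num.sqrt pi != 0 :> R by rewrite gt_eqF// sqrtr_gt0 pi_gt0.
have x1 : x != 0 by rewrite gt_eqF.
have [_ odd] := cvg_series_parity _ _ _ hA hB.
have := cvg_seriesZ _ (4 / (Num.sqrt pi * x)) _ odd.
have -> : 4 / (Num.sqrt pi * x) * ((expR x * Ei (- x) - expR (- x) * Ei x) / 2) =
  2 / (Num.sqrt pi * x) * (expR x * Ei (- x) - expR (- x) * Ei x) :> R by field;
    rewrite x1 s0.
apply: cvg_series_eq => k.
rewrite /dterm rgamma_duplication /ei_term ln_div ?posrE//.
have := psi_duplication (R := R) k.
move: (psi _) (psi (k%:R + 1)) (psi _) => a b c h.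
have -> : 2 * (ln x - ln 2) - c - b = 2 * (ln x - a) by lra.
rewrite -exprM expr_div_n (exprS x) (exprS 2).
have p0 : (2 ^+ (2 * k) : R) != 0 by rewrite expf_neq0.
have f0 : ((2 * k).+1`!%:R : R) != 0 by rewrite pnatr_eq0 -lt0n fact_gt0.
move: p0 f0; move: (2 ^+ (2 * k) : R) ((2 * k).+1`!%:R : R) (x ^+ (2 * k))
  (Num.sqrt pi : R) s0 (ln x) => p f X s s0 L p0 f0.
by field; rewrite p0 f0 s0 x1.
Qed.

(** The extra term rgamma (3/2) is the k = 0 term that completes the shifted
    series to even and odd parts. *)
Lemma dterm_five_half {R : realType} (x : R) : 0 < x ->
  exists D, series (dterm ((x / 2) ^+ 2) (5 / 2) (2 * ln (x / 2))) @ \oo --> D /\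
  (x / 2) ^+ 2 * D + rgamma (3 / 2) =
  (Num.sqrt pi)^-1 * (expR x * Ei (- x) + expR (- x) * Ei x
     - (expR x * Ei (- x) - expR (- x) * Ei x) / x).
Proof.
move=> x0; have [hA hB] := ei_term_cvg x x0.
have s0 : Num.sqrt pi != 0 :> R by rewrite gt_eqF// sqrtr_gt0 pi_gt0.
have x1 : x != 0 by rewrite gt_eqF.
have w0 : 0 < x / 2 by rewrite divr_gt0.
have [cD _] := is_derive_gserB (x / 2) (5 / 2) w0 (divr_gt0 (ltr0Sn _ 4) (ltr0Sn _ 1)).
have /cvg_ex[/= D hD] := cD; exists D; split; first exact: hD.
have [even odd] := cvg_series_parity _ _ _ hA hB.
have h1 := cvg_seriesZ _ (2 / Num.sqrt pi) _
  (cvg_seriesD _ _ _ _ even (cvg_seriesZ _ (- x^-1) _ odd)).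
have r32 : rgamma (3 / 2) = 2 / Num.sqrt pi :> R.
  have := @rgamma_duplication R 0.
  rewrite !add0r rgamma1 mul1r muln0 factS fact0 muln1 expr1 divr1; exact.
have h2 : series (fun k => 2 / Num.sqrt pi *
  (ei_term x (2 * k)%N + - x^-1 * ei_term x (2 * k).+1)) @ \oo -->
    rgamma (3 / 2) + (x / 2) ^+ 2 * D.
  have -> : rgamma (3 / 2) =
      2 / Num.sqrt pi * (ei_term x (2 * 0)%N + - x^-1 * ei_term x (2 * 0).+1).
    rewrite r32 muln0 /ei_term factS fact0 muln1 -(natr1 1) psiS// expr0 expr1.
    by field; rewrite s0 x1.
  apply: (cvg_seriesS (fun k => 2 / Num.sqrt pi *
    (ei_term x (2 * k)%N + - x^-1 * ei_term x (2 * k).+1))).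
  apply: cvg_series_eq (cvg_seriesZ _ ((x / 2) ^+ 2) _ hD) => j.
  set k := j.+1.
  have k0 : 0 < k%:R :> R by [].
  rewrite /dterm.
  have -> : j%:R + 5 / 2 = k%:R + 3 / 2 :> R by rewrite /k -natr1; field.
  rewrite natr1 -/k (rgammaS k%:R).
  have -> : psi k%:R = psi (k%:R + 1) - k%:R^-1 :> R by rewrite psiS// addrK.
  set P := (X in _ * (_ * X) = _).
  have -> : (x / 2) ^+ 2 * ((x / 2) ^+ 2 ^+ j *
    (k%:R * rgamma (k%:R + 1) * rgamma (k%:R + 3 / 2)) * P) =
     (x / 2) ^+ 2 ^+ k * (k%:R * (rgamma (k%:R + 1) * rgamma (k%:R + 3 / 2))) * P.
    by move: P ((x / 2) ^+ 2) => P y; rewrite [y ^+ k](exprS y j); ring.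
  rewrite /P rgamma_duplication /ei_term ln_div ?posrE//.
  have := psi_duplication (R := R) k.
  have -> : psi (2 * k).+2%:R = psi (2 * k).+1%:R +
    ((2 * k).+1%:R)^-1 :> R by rewrite -(natr1 (2 * k).+1) psiS.
  have f0 : ((2 * k)`!%:R : R) != 0 by rewrite pnatr_eq0 -lt0n fact_gt0.
  rewrite (factS (2 * k)) (exprS x (2 * k)) (exprS 2 (2 * k)) -exprM expr_div_n.
  have p0 : (2 ^+ (2 * k) : R) != 0 by rewrite expf_neq0.
  move: f0; move: ((2 * k)`!)%N => F f0; rewrite natrM.
  have -> : (2 * k).+1%:R = 2 * k%:R + 1 :> R by rewrite -(natr1 (2 * k)) natrM.
  move: p0 k0; move: (k%:R : R) (F%:R : R) f0 (2 ^+ (2 * k) : R) (x ^+ (2 * k)) =>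
    K f f0 p X p0 K0.
  move: (psi (K + 3 / 2)) (psi (K + 1)) (psi (2 * K + 1)) (ln x) (ln 2) => a b c L l h.
  have -> : 2 * (L - l) - a - (b - K^-1) = 2 * (L - c - (2 * K + 1)^-1) + K^-1 by lra.
  by field; rewrite s0 f0 p0 x1 !gt_eqF//; lra.
have := cvg_unique _ h1 h2 => /(_ _)E.
rewrite addrC -E//; by field; rewrite s0 x1.
Qed.

(** * The limits *)

(** The difference quotient at 0 of is_derive_gserB, with the sum of the
    derivative series named. *)
Lemma cvg_gserB {R : realType} (w b D : R) : 0 < w -> 0 < b ->
  series (dterm (w ^+ 2) b (2 * ln w)) @ \oo --> D ->
  h^-1 * (w `^ h * gser (w ^+ 2) 1 (b + h) - w `^ (- h) * gser (w ^+ 2) b (1 - h))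
    @[h --> 0^'] --> D.
Proof.
move=> w0 b0 cD; have [_ d] := is_derive_gserB w b w0 b0.
have e : limn (series (dterm (w ^+ 2) b (2 * ln w))) = D by apply/cvg_lim => //;
  exact: cD.
rewrite e in d.
have := cvg_of_is_derive _ _ _ d; apply: cvg_near_eq; near=> h.
by rewrite !addr0 oppr0 !addr0 powRr0 (gser_sym _ b 1) subrr subr0.
Unshelve. all: by end_near. Qed.

Lemma powR_three_half {R : realType} (a : R) : 0 < a -> a `^ (3 / 2) = a * Num.sqrt a.
Proof.
move=> a0; rewrite (_ : 3 / 2 = 2^-1 + 1%:R); last by field.
by rewrite powRDn// powR12_sqrt ?ltW// expr1 mulrC.
Qed.

(** The bracket in braces of the closed form. *)
Definition ei_bracket {R : realType} (x : R) (k : nat) : R :=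
  x ^+ (k - 1) * (expR (- x) * Ei x + (-1) ^+ k * expR x * Ei (- x)) -
     \sum_(1 <= j < k)
       ((j - 1)`!)%:R * (1 + (-1) ^+ (k + j)) * x ^+ (k - j - 1).

Lemma ei_bracket_rec {R : realType} (x : R) (i : nat) :
  ei_bracket x i.+3 = x ^+ 2 * ei_bracket x i.+1 - 2 * i`!%:R * x.
Proof.
rewrite /ei_bracket [in LHS]big_nat_recr//= [in LHS]big_nat_recr//=.
have -> : (i.+3 + i.+2 = (2 * i.+2).+1)%N by lia.
have -> : (i.+3 + i.+1 = (2 * i.+2))%N by lia.
have -> : (i.+3 - i.+1 - 1 = 1)%N by lia.
have -> : (i.+3 - i.+2 - 1 = 0)%N by lia.
have e1 : (-1) ^+ (2 * i.+2) = 1 :> R by rewrite exprM sqrrN !expr1n.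
have e2 : (-1) ^+ (2 * i.+2).+1 = -1 :> R by rewrite exprS e1 mulr1.
rewrite e1 e2 subrr mulr0 mul0r addr0 expr1 (_ : (i.+1 - 1 = i)%N); last by lia.
rewrite (eq_big_nat _ _ (F2 := fun j => x ^+ 2 *
  ((j - 1)`!%:R * (1 + (-1) ^+ (i.+1 + j)) * x ^+ (i.+1 - j - 1)))); last first.
  move=> j /andP[j1 ji]; have -> : (i.+3 - j - 1 = 2 + (i.+1 - j - 1))%N by lia.
  by rewrite (exprD x) (_ : (i.+3 + j = 2 + (i.+1 + j))%N)// (exprD _ 2) sqrrN expr1n
    mul1r; ring.
rewrite -mulr_sumr; move: (\sum_(_ <= _ < _) _) => s.
rewrite (_ : (i.+3 - 1 = 2 + i)%N); last by lia.
rewrite (exprD x) (_ : (i.+3 = 2 + i.+1)%N)// (exprD _ 2) sqrrN expr1n mul1r.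
ring.
Qed.

(** The factor in front of the sum in the closed form. *)
Definition limit_coef {R : realType} (x : R) (n : nat) : R :=
  2 / pi `^ (3 / 2) * ((n - 1)`!)%:R * (2 / x) `^ (n%:R - 1 / 2).

Lemma limit_coefE {R : realType} (x : R) (n : nat) : 0 < x ->
  limit_coef x n.+1 = 2 / (pi * Num.sqrt pi) * n`!%:R * (2 / x) `^ (1 / 2) * (2 / x) ^+ n.
Proof.
move=> x0; rewrite /limit_coef powR_three_half ?pi_gt0// subn1 /=.
rewrite (_ : n.+1%:R - 1 / 2 = 1 / 2 + n%:R :> R); last by rewrite -natr1; field.
by rewrite powRDn ?divr_gt0// mulrA.
Qed.

Lemma powR_half_inv {R : realType} (x : R) : 0 < x ->
  (x / 2) `^ (1 / 2) = (2 / x) `^ (1 / 2) * (x / 2).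
Proof.
move=> x0; have w0 : 0 < x / 2 by rewrite divr_gt0.
have e1 : (2 / x) `^ (1 / 2) * (x / 2) `^ (1 / 2) = 1.
  rewrite -powRM ?divr_ge0 ?(ltW x0)// (_ : 2 / x * (x / 2) = 1) ?powR1//.
  by field; rewrite gt_eqF.
have e2 : (x / 2) `^ (1 / 2) * (x / 2) `^ (1 / 2) = x / 2.
  rewrite -powRD ?(gt_eqF w0) ?implybT// (_ : 1 / 2 + 1 / 2 = 1); last by field.
  by rewrite powRr1// ltW.
by have := congr1 (fun u => (2 / x) `^ (1 / 2) * u) e2; rewrite mulrA e1 mul1r.
Qed.

(** Limits are taken in the variable h = nu - n. *)
Lemma bsDiff_limit1 {R : realType} (x : R) : 0 < x ->
  bsDiff x (h + 1%:R) / sin (pi * (h + 1%:R)) @[h --> 0^'] -->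
  limit_coef x 1 * \sum_(0 <= i < 1) wcoef 1 i * ei_bracket x i.+1.
Proof.
move=> x0; have w0 : 0 < x / 2 by rewrite divr_gt0.
have b0 : 0 < 3 / 2 :> R by rewrite divr_gt0.
have H := cvg_gserB (x / 2) (3 / 2) _ w0 b0 (dterm_three_half x x0).
have H2 : h^-1 * bsDiff x (h + 1%:R) @[h --> 0^'] -->
   (x / 2) `^ (1 / 2) * (2 / (Num.sqrt pi * x) * (expR x * Ei (- x) - expR (- x) * Ei x)).
  apply: cvg_near_eq (cvgM (cvg_cst ((x / 2) `^ (1 / 2))) H); near=> h.
  rewrite /= bsDiffE//.
  have -> : h + 1%:R - 1 / 2 = 1 / 2 + h by field.
  have -> : 3 / 2 - (h + 1%:R) = 1 / 2 + - h by field.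
  have -> : h + 1%:R + 1 / 2 = 3 / 2 + h by field.
  have -> : 2 - (h + 1%:R) = 1 - h by ring.
  rewrite !(@powRD _ (x / 2) (1 / 2)) ?(gt_eqF w0) ?implybT//.
  ring.
have := cvg_div_sin (fun h => bsDiff x (h + 1%:R)) _ 1 H2.
rewrite limit_coefE// big_nat1 /wcoef /ei_bracket big_geq//.
rewrite (_ : (2 * 1 - 0 - 2 = 0)%N)// subnn bin0 !expr1 fact0 !expr0.
rewrite (powR_half_inv x x0).
have s0 : Num.sqrt pi != 0 :> R by rewrite gt_eqF// sqrtr_gt0 pi_gt0.
have p0 : pi != 0 :> R by rewrite gt_eqF// pi_gt0.
have x1 : x != 0 by rewrite gt_eqF.
set a := _ * _ / pi; set b := (X in _ -> _ --> X).
suff -> : a = b by [].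
rewrite /a /b.
move: s0; move: (Num.sqrt pi : R) ((2 / x) `^ (1 / 2)) => s v s0.
move: p0; move: (pi : R) => p p0.
by field; rewrite ?s0 ?p0 ?x1.
Unshelve. all: by end_near. Qed.

(** Here Z(3/2,-h) = g(3/2) g(-h) + y Z(5/2,1-h), and g(-h)/h tends to -1. *)
Lemma bsDiff_limit2 {R : realType} (x : R) : 0 < x ->
  bsDiff x (h + 2%:R) / sin (pi * (h + 2%:R)) @[h --> 0^'] -->
  limit_coef x 2 * \sum_(0 <= i < 2) wcoef 2 i * ei_bracket x i.+1.
Proof.
move=> x0; have w0 : 0 < x / 2 by rewrite divr_gt0.
have w1 : x / 2 != 0 by rewrite gt_eqF.
have b0 : 0 < 5 / 2 :> R by rewrite divr_gt0.
have [D [cD DE]] := dterm_five_half x x0.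
have H := cvg_gserB (x / 2) (5 / 2) _ w0 b0 cD.
have c1 : (x / 2) `^ (-1 * h) @[h --> 0^'] --> (1 : R).
  have := cvg_dnbhs_derive _ _ _ (is_derive_powRr (x / 2) (-1) 0 w0).
  by rewrite mulr0 powRr0.
have c2 := @cvg_rgamma1B R.
set r := (x / 2) `^ (1 / 2).
have H2 : h^-1 * bsDiff x (h + 2%:R) @[h --> 0^'] -->
   r * (x / 2) * D + r / (x / 2) * rgamma (3 / 2) * (1 * 1).
  apply: cvg_near_eq (cvgD (cvgM (cvg_cst (r * (x / 2))) H)
    (cvgM (cvg_cst (r / (x / 2) * rgamma (3 / 2))) (cvgM c1 c2))); near=> h.
  have h0 : h != 0 by near: h; exact: nbhs_dnbhs_neq.
  rewrite /= bsDiffE//.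
  have -> : h + 2%:R - 1 / 2 = 1 / 2 + h + 1%:R by field.
  have e : (x / 2) `^ (3 / 2 - (h + 2%:R)) = r / (x / 2) * (x / 2) `^ (- h).
    rewrite (_ : r = (x / 2) `^ (- (1 / 2) + 1%:R)); last by rewrite /r; congr (_ `^ _);
      field.
    rewrite powRDn// expr1 mulfK// -powRD ?w1 ?implybT//.
    by congr (_ `^ _); field.
  have -> : h + 2%:R + 1 / 2 = 5 / 2 + h by field.
  have -> : 2 - (h + 2%:R) = - h by ring.
  rewrite e (gser_shift _ (3 / 2)); last by rewrite exprn_ge0// ltW.
  rewrite (_ : 3 / 2 + 1 = 5 / 2); last by field.
  rewrite (rgammaS (- h)) (_ : - h + 1 = 1 - h); last by ring.
  rewrite powRDn// powRD ?w1 ?implybT// -/r mulN1r.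
  move: (gser _ _ _) (gser _ _ _) (rgamma _) (rgamma _) => g1 g2 r1 r2.
  move: ((x / 2) `^ h) ((x / 2) `^ (- h)) (x / 2) w1 => u v w w1.
  by field; rewrite h0 w1.
have := cvg_div_sin (fun h => bsDiff x (h + 2%:R)) _ 2 H2.
rewrite limit_coefE//.
have -> : r * (x / 2) * D + r / (x / 2) * rgamma (3 / 2) * (1 * 1) =
    r / (x / 2) * ((x / 2) ^+ 2 * D + rgamma (3 / 2)).
  by field; rewrite gt_eqF.
rewrite DE big_nat_recr//= big_nat1 /wcoef /ei_bracket big_geq// big_nat1.
rewrite (_ : (2 * 2 - 0 - 2 = 2)%N)// (_ : (2 * 2 - 1 - 2 = 1)%N)// !subnn !subn1/=
  bin1 bin1.
rewrite /r (powR_half_inv x x0).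
have s0 : Num.sqrt pi != 0 :> R by rewrite gt_eqF// sqrtr_gt0 pi_gt0.
have p0 : pi != 0 :> R by rewrite gt_eqF// pi_gt0.
have x1 : x != 0 by rewrite gt_eqF.
set a := _ * _ / pi; set b := (X in _ -> _ --> X).
suff -> : a = b by [].
rewrite /a /b !factS fact0.
move: s0; move: (Num.sqrt pi : R) ((2 / x) `^ (1 / 2)) => s v s0.
move: p0; move: (pi : R) => p p0.
by field; rewrite ?s0 ?p0 ?x1.
Unshelve. all: by end_near. Qed.

(** bsDiff_rec divided by the sine; the last term is the limit of the
    inhomogeneous part by cvg_rgamma_sin. *)
Lemma bsDiff_limit_step {R : realType} (x : R) (m : nat) (l1 l2 : R) : 0 < x ->
  bsDiff x (h + m.+1%:R) / sin (pi * (h + m.+1%:R)) @[h --> 0^'] --> l1 ->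
  bsDiff x (h + m.+2%:R) / sin (pi * (h + m.+2%:R)) @[h --> 0^'] --> l2 ->
  bsDiff x (h + m.+3%:R) / sin (pi * (h + m.+3%:R)) @[h --> 0^'] -->
  l1 + (2 * m.+2%:R - 1) / x * l2 -
    (2 / x) `^ (1 / 2) * (2 / x) ^+ m.+1 / Num.sqrt pi * (m`!%:R / pi).
Proof.
move=> x0 H1 H2; have w0 : 0 < x / 2 by rewrite divr_gt0.
have w1 : x / 2 != 0 by rewrite gt_eqF.
have H3 := @cvg_rgamma_sin R m.
have c1 : (2 * (h + m.+2%:R) - 1) / x @[h --> (0:R)^'] --> (2 * m.+2%:R - 1) / x.
  apply: cvgM; last exact: cvg_cst.
  apply: cvgB; last exact: cvg_cst.
  by apply: cvgM; [exact: cvg_cst|exact: cvg_dnbhsDl].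
have c2 : (x / 2) `^ (1 / 2 - (h + m.+2%:R)) * rgamma (1 / 2) @[h --> (0:R)^'] -->
    (2 / x) `^ (1 / 2) * (2 / x) ^+ m.+1 / Num.sqrt pi.
  rewrite rgamma_half; apply: cvgM; last exact: cvg_cst.
  have := cvg_dnbhs_derive _ _ _ (is_derive_powRr (x / 2) (-1) 0 w0).
  rewrite mulr0 powRr0 => c.
  have e : (x / 2) `^ (1 / 2) / (x / 2) ^+ m.+2 = (2 / x) `^ (1 / 2) * (2 / x) ^+ m.+1.
    have -> : (2 / x) ^+ m.+1 = ((x / 2) ^+ m.+1)^-1 by rewrite -invf_div exprVn.
    rewrite (powR_half_inv x x0) (exprS _ m.+1).
    have : (x / 2) ^+ m.+1 != 0 by rewrite expf_neq0.
    move: ((x / 2) ^+ m.+1) ((2 / x) `^ (1 / 2)) (x / 2) w1 => p v w w1 p0.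
    by field; rewrite w1 p0.
  rewrite -e -[X in _ --> X]mulr1.
  apply: cvg_near_eq (cvgM (cvg_cst ((x / 2) `^ (1 / 2) / (x / 2) ^+ m.+2)) c); near=> h.
  rewrite /= -(powR_mulrn m.+2 (ltW w0)) -powRN.
  rewrite -!powRD ?w1 ?implybT//; congr (_ `^ _); ring.
rewrite -mulrN -mulNr.
apply: cvg_near_eq (cvgD (cvgD H1 (cvgM c1 H2)) (cvgM c2 H3)); near=> h.
rewrite -(natr1 m.+2) addrA (bsDiff_rec _ _ x0).
have e1 : h + m.+2%:R - 1 = h + m.+1%:R by rewrite -(natr1 m.+1); ring.
have e2 : 2 - (h + m.+2%:R) = - (h + m%:R) by rewrite -(natr1 m.+1) -(natr1 m); ring.
have s1 : sin (pi * (h + m.+2%:R + 1)) = - sin (pi * (h + m.+2%:R)).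
  by have := sin_piDn (h + m.+2%:R) 1; rewrite expr1 mulN1r.
have s2 : sin (pi * (h + m.+1%:R)) = - sin (pi * (h + m.+2%:R)).
  have := sin_piDn (h + m.+1%:R) 1; rewrite expr1 mulN1r.
  by rewrite -(natr1 m.+1) addrA => ->; rewrite opprK.
have s3 : sin (pi * (h + m%:R)) = sin (pi * (h + m.+2%:R)).
  have := sin_piDn (h + m%:R) 2; rewrite sqrrN expr1n mul1r => <-.
  by congr (sin (pi * _)); rewrite -(natr1 m.+1) -(natr1 m); ring.
rewrite !fctE /= e1 e2 s1 s2 s3 invrN; ring.
Unshelve. all: by end_near. Qed.

Lemma bsDiff_limit {R : realType} (x : R) (m : nat) : 0 < x ->
  bsDiff x (h + m.+1%:R) / sin (pi * (h + m.+1%:R)) @[h --> 0^'] -->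
  limit_coef x m.+1 * \sum_(0 <= i < m.+1) wcoef m.+1 i * ei_bracket x i.+1.
Proof.
move=> x0.
pose P m := bsDiff x (h + m.+1%:R) / sin (pi * (h + m.+1%:R)) @[h --> 0^'] -->
  limit_coef x m.+1 * \sum_(0 <= i < m.+1) wcoef m.+1 i * ei_bracket x i.+1.
suff : P m /\ P m.+1 by case.
elim: m => [|m [H1 H2]]; first by split; [exact: bsDiff_limit1|exact: bsDiff_limit2].
split => //.
rewrite /P; have -> : limit_coef x m.+3 * \sum_(0 <= i < m.+3) wcoef m.+3 i *
  ei_bracket x i.+1 =
    limit_coef x m.+1 * \sum_(0 <= i < m.+1) wcoef m.+1 i * ei_bracket x i.+1 +
    (2 * m.+2%:R - 1) / x *
      (limit_coef x m.+2 * \sum_(0 <= i < m.+2) wcoef m.+2 i * ei_bracket x i.+1) -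
    (2 / x) `^ (1 / 2) * (2 / x) ^+ m.+1 / Num.sqrt pi * (m`!%:R / pi); last first.
  exact: (bsDiff_limit_step x m _ _ x0 H1 H2).
rewrite !limit_coefE//.
have := sum_wcoef_rec m (fun i => ei_bracket x i.+1) x (ei_bracket_rec x).
move: (\sum_(0 <= i < m.+3) _) (\sum_(0 <= i < m.+2) _) (\sum_(0 <= i < m.+1) _) =>
  S3 S2 S1 h.
have s0 : Num.sqrt pi != 0 :> R by rewrite gt_eqF// sqrtr_gt0 pi_gt0.
have p0 : pi != 0 :> R by rewrite gt_eqF// pi_gt0.
have x1 : x != 0 by rewrite gt_eqF.
rewrite (factS m.+1) (factS m).
have -> : (2 / x) ^+ m.+2 = (2 / x) ^+ m * (4 / x ^+ 2) by rewrite !exprS; field.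
have -> : (2 / x) ^+ m.+1 = (2 / x) ^+ m * (2 / x) by rewrite exprSr.
have f0 : (m`!%:R : R) != 0 by rewrite pnatr_eq0 -lt0n fact_gt0.
move: f0; move: (m`!)%N => f f0; rewrite !natrM.
move: h; rewrite natrD natrM.
have -> : m.+2%:R = m%:R + 2 :> R by rewrite -(natr1 m.+1) -(natr1 m); ring.
have -> : m.+1%:R = m%:R + 1 :> R by rewrite -(natr1 m).
move: s0; move: (Num.sqrt pi : R) => s s0; move: p0; move: (pi : R) => p p0.
move: ((2 / x) `^ (1 / 2)) ((2 / x) ^+ m) (m%:R : R) (f%:R : R) => v q M F h.
transitivity (2 / (p * s) * F * v * q / x ^+ 2 * (4 * (M + 2) * (M + 1) * S3)).
  by field; rewrite x1 s0 p0.
by rewrite h; field; rewrite x1 s0 p0.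
Qed.

Theorem corollary2p3 (R : realType) (x : R) (n : nat) (hx : 0 < x)
    (hn : (0 < n)%N) :
  (besselI (nu - 1 / 2) x - struveL (1 / 2 - nu) x) / sin (pi * nu)
    @[nu --> (n%:R : R)^'] -->
  2 / pi `^ (3 / 2) * ((n - 1)`!)%:R * (2 / x) `^ (n%:R - 1 / 2) *
  \sum_(1 <= k < n.+1)
    'C(2 * n - k - 1, n - 1)%:R *
    ((2 : R) ^ (k%:Z - (2 * n)%:Z) / ((k - 1)`!)%:R) *
    (x ^+ (k - 1) * (expR (- x) * Ei x + (-1) ^+ k * expR x * Ei (- x)) -
     \sum_(1 <= j < k)
       ((j - 1)`!)%:R * (1 + (-1) ^+ (k + j)) * x ^+ (k - j - 1)).
Proof.
apply: (dnbhs_shift (fun nu => bsDiff x nu / sin (pi * nu))).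
rewrite (eq_big_nat _ _ (F2 := fun k => wcoef n (k - 1) * ei_bracket x k)); last first.
  by move=> k kn; rewrite wcoefE.
case: n hn => // m _; rewrite big_add1 /=.
rewrite (eq_big_nat _ _ (F2 := fun i => wcoef m.+1 i * ei_bracket x i.+1)); last first.
  by move=> i _; rewrite subn1.
exact: bsDiff_limit.
Qed.
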